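(* Consider Landweber iteration, i.e. $\gamma_i^{(t)}=g(t,\lambda_i)$ with $g(t,\lambda)=1-(1-\lambda^2)^{t^2}$ for $t\ge1$ and $g(t,\lambda)=(t\lambda)^2$ for $t\in[0,1]$, $\lambda\in(0,1]$ (for which $\beta_-\min((t\lambda)^\rho,1)\le g(t,\lambda)\le\min(\beta_+(t\lambda)^\rho,1)$ with $\rho=2$, $\beta_-=\frac12$, $\beta_+=1$). Suppose that there are $\nu_-,\nu_+>0$ and an integer $2\le L\le D$ with $D/L\in\mathbb{N}$ such that for all $L\le k\le D$ $$0<L^{-1/\nu_-}\le\frac{\lambda_k}{\lambda_{\lceil k/L\rceil}}\quad\text{and}\quad\frac{\lambda_k}{\lambda_{\lfloor k/L\rfloor}}\le L^{-1/\nu_+}<1,$$ that $\rho=2>\max(\nu_+,1+\frac{\nu_+}2)$, and that $|\kappa-D\delta^2|\le C_\kappa\sqrt D\,\delta^2$ with $C_\kappa\in[0,C_\circ)$. Let $c_\mu>0$. Then for all signals $\mu\in\mathcal C(L,c_\mu)$, where $$\mathcal C(L,c_\mu)=\Big\{\mu\in\mathbb{R}^D:\ \forall i=1,\dots,D/L:\ \mu_{(L-1)i+1}^2+\cdots+\mu_{Li}^2\ge c_\mu\mu_i^2\Big\},$$ the oracle inequality $$\mathbb{E}\big[\|\widehat\mu^{(\tau)}-\mu\|^2\big]\le C_{\tau,\mathfrak s}\,\mathbb{E}\big[\|\widehat\mu^{(t_{\mathfrak s})}-\mu\|^2\big]$$ holds with a constant $C_{\tau,\mathfrak s}$ depending only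 on $\rho,\beta_-,\beta_+,L,\nu_-,\nu_+,c_\mu,C_\kappa,C_\circ$.
   Context: Fix $D\in\mathbb{N}$, a noise level $\delta>0$, numbers $1\ge\lambda_1\ge\dots\ge\lambda_D>0$ and a signal $\mu\in\mathbb{R}^D$. One observes $Y_i=\lambda_i\mu_i+\delta\varepsilon_i$, $i=1,\dots,D$, with $\varepsilon_i$ independent standard normal. Estimators: $\widehat\mu_i^{(t)}=\gamma_i^{(t)}\lambda_i^{-1}Y_i$, $t\ge0$. $\|\cdot\|$ is the Euclidean norm. Notation: $R_t^2=\sum_i(1-\gamma_i^{(t)})^2Y_i^2$; $B_t^2(\mu)=\sum_i(1-\gamma_i^{(t)})^2\mu_i^2$; $V_t=\delta^2\sum_i(\gamma_i^{(t)})^2\lambda_i^{-2}$; $V_{t,\lambda}=\delta^2\sum_i(\gamma_i^{(t)})^2$. Indices: $t_\circ=\inf\{t\ge0:V_{t,\lambda}=C_\circ D^{1/2}\delta^2\}$ with a constant $C_\circ\ge1$, $C_\circ<D^{1/2}$; for a threshold $\kappa>0$, $\tau=\inf\{t\ge t_\circ:R_t^2\le\kappa\}$; $t_{\mathfrak s}=t_{\mathfrak s}(\mu)=\inf\{t\ge t_\circ:B_t^2(\mu)\le V_t\}$. *)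

(* Defs.v *)
(* Mathematical Components with MathComp-Analysis. *)
From HB Require Import structures.
From mathcomp Require Import all_boot all_order all_algebra.
From mathcomp Require Import all_classical all_reals all_analysis.
Set Implicit Arguments.
Unset Strict Implicit.
Unset Printing Implicit Defensive.
Import Order.TTheory GRing.Theory Num.Theory.
Import numFieldNormedType.Exports.
Local Open Scope classical_set_scope.
Local Open Scope ring_scope.

(* The norm `|x| that MathComp-Analysis puts on row vectors is the sup norm. *)
Definition euclidean_norm (R : realType) (D : nat) (x : 'rV[R]_D) : R :=
  Num.sqrt (\sum_(i < D) x 0 i ^+ 2).

(* One-based access: [coord1 v k] is v_k for 1 <= k <= D, that is, the entry of
   index k - 1 of v.  It is meaningless for other k. *)
Definition coord1 (R : realType) (D : nat) (v : 'rV[R]_D) (k : nat) : R :=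
  if insub k.-1 is Some i then v 0 i else 0.

Definition ceil_divn (k L : nat) : nat := (k %/ L + ~~ (L %| k))%N.

(* The two branches agree at t = 1; for non-integer t ^+ 2 the power is the real
   power, with 0 `^ s = 0 for s != 0. *)
Definition landweber (R : realType) (t l : R) : R :=
  if t <= 1 then (t * l) ^+ 2 else 1 - (1 - l ^+ 2) `^ (t ^+ 2).

(* Below, g is a filter function, gamma_i^(t) = g t (lambda_i), and y stands for
   a realization of the observation vector Y. *)

Definition observation (R : realType) (D : nat) (lam mu : 'rV[R]_D) (delta : R)
    (eps : 'rV[R]_D) : 'rV[R]_D :=
  \row_(i < D) (lam 0 i * mu 0 i + delta * eps 0 i).

Definition estimator (R : realType) (g : R -> R -> R) (D : nat)
    (lam : 'rV[R]_D) (t : R) (y : 'rV[R]_D) : 'rV[R]_D :=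
  \row_(i < D) (g t (lam 0 i) * (lam 0 i)^-1 * y 0 i).

(* R_t^2 *)
Definition residual2 (R : realType) (g : R -> R -> R) (D : nat)
    (lam : 'rV[R]_D) (t : R) (y : 'rV[R]_D) : R :=
  \sum_(i < D) (1 - g t (lam 0 i)) ^+ 2 * y 0 i ^+ 2.

(* B_t^2(mu) *)
Definition bias2 (R : realType) (g : R -> R -> R) (D : nat)
    (lam : 'rV[R]_D) (t : R) (mu : 'rV[R]_D) : R :=
  \sum_(i < D) (1 - g t (lam 0 i)) ^+ 2 * mu 0 i ^+ 2.

(* V_t *)
Definition variance_strong (R : realType) (g : R -> R -> R) (D : nat)
    (lam : 'rV[R]_D) (delta t : R) : R :=
  delta ^+ 2 * \sum_(i < D) g t (lam 0 i) ^+ 2 * (lam 0 i) ^- 2.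

(* V_{t,lambda} *)
Definition variance_weak (R : realType) (g : R -> R -> R) (D : nat)
    (lam : 'rV[R]_D) (delta t : R) : R :=
  delta ^+ 2 * \sum_(i < D) g t (lam 0 i) ^+ 2.

Definition t_circ (R : realType) (g : R -> R -> R) (D : nat)
    (lam : 'rV[R]_D) (delta Ccirc : R) : R :=
  inf [set t : R | 0 <= t /\
    variance_weak g lam delta t = Ccirc * Num.sqrt D%:R * delta ^+ 2].

Definition tau (R : realType) (g : R -> R -> R) (D : nat)
    (lam : 'rV[R]_D) (delta Ccirc kappa : R) (y : 'rV[R]_D) : R :=
  inf [set t : R | t_circ g lam delta Ccirc <= t /\
    residual2 g lam t y <= kappa].

Definition t_strong (R : realType) (g : R -> R -> R) (D : nat)
    (lam : 'rV[R]_D) (delta Ccirc : R) (mu : 'rV[R]_D) : R :=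
  inf [set t : R | t_circ g lam delta Ccirc <= t /\
    bias2 g lam t mu <= variance_strong g lam delta t].

Definition signal_class (R : realType) (D L : nat) (cmu : R) :
    set 'rV[R]_D :=
  [set mu | forall i : nat, (1 <= i <= D %/ L)%N ->
    \sum_(((L - 1) * i + 1)%N <= j < (L * i).+1) coord1 mu j ^+ 2
      >= cmu * coord1 mu i ^+ 2].

Definition mutually_independent (R : realType) (d : measure_display)
    (T : measurableType d) (P : probability T R) (D : nat)
    (X : 'I_D -> {RV P >-> R}) : Prop :=
  forall (J : {set 'I_D}) (A : 'I_D -> set R),
    (forall i, measurable (A i)) ->
    P (\bigcap_(i in [set` J]) (X i @^-1` A i)) =
    (\prod_(i in J) P (X i @^-1` A i))%E.

Definition standard_normal (R : realType) (d : measure_display)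
    (T : measurableType d) (P : probability T R) (X : {RV P >-> R}) : Prop :=
  forall A : set R, measurable A ->
    distribution P X A = normal_prob (0 : R) (1 : R) A.

(* Main.v *)
(* In units of delta, R_t^2 is a weighted noncentral chi-square sum, so Chernoff
   bounds at |z| = (8 sqrt D)^-1 control both of its tails in terms of the weak
   bias \sum_i (1 - g_i)^2 (lam_i mu_i)^2 and the weak variance
   v t = \sum_i g_i^2; note v >= Co sqrt D after t_circ, with Co > C_kappa.
   - Late stopping: past time K t_s the weak bias is at most a small multiple of
     v, so P(tau > t) decays like exp (- c v t / sqrt D), while V_t grows only
     polynomially along a geometric grid. This bounds the noise part of the
     loss by a multiple of V_(t_s), moments being taken jointly with single
     noise coordinates.
   - Early stopping: before t_s, on dyadic levels of the weak bias, stopping at a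
     time of large weak bias is a lower-tail event. Hence the mean weak bias at
     tau is at most a multiple of v t_s, and min (4 t_s^2, lam_D^-2) converts it
     into a bound on the strong bias by V_(t_s).
   The upper spectral condition, through L^(-2/nu_+) L < 1, gives
   \sum_i g_i <= C v and V_t <= C t^2 v; the lower one gives
   min (4 t^2, lam_D^-2) v <= C V_t. *)
Require Import Defs.
From HB Require Import structures.
From mathcomp Require Import all_boot all_order all_algebra.
From mathcomp Require Import all_classical all_reals all_analysis.
From mathcomp Require Import measurable_realfun ring lra zify.
Import Order.TTheory GRing.Theory Num.Theory.
Import numFieldNormedType.Exports.
Local Open Scope classical_set_scope.
Local Open Scope ring_scope.

(** The loss is evaluated at a time that depends on the same noise. To separate the two, the loss is
    dominated pointwise by functions built at deterministic times: the indicator of the event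
    [tau > t] is bounded by an exponential of the residual at t, and a squared noise coordinate by a
    multiple of exp (eps^2 / 8). The product is the exponential of a quadratic form that is diagonal
    in the noise, so one explicit Gaussian integral and independence give the joint moment, without
    Cauchy-Schwarz. Of [tau] only the crossing property enters: residual above kappa before it, at
    most kappa after it. The size of z makes the second-order term 4 z^2 D a constant; tail
    exponents are then of order v / sqrt D, which is why every estimate starts from a weak variance
    of at least sqrt D. The grid for late stopping has ratio L^(1/nu_-) because each step then
    multiplies the number of saturated coordinates, and with it the lower bound on v, by L, while
    V_t grows at most like the fourth power of the ratio. *)

Lemma le_expectation_ge0 (R : realType) (d : measure_display)
    (T : measurableType d) (P : probability T R) (X Y : T -> R) :
  (forall w, 0 <= X w) -> (forall w, X w <= Y w) -> ('E_P[X] <= 'E_P[Y])%E.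
Proof.
move=> X0 XY; rewrite unlock.
have Y0 w : 0 <= Y w by exact: le_trans (XY w).
rewrite !ge0_integralTE; [|by move=> w; rewrite lee_fin..].
apply: ereal_sup_le => _ [h /= hX <-]; exists h => //= w.
by apply: le_trans (hX w) _; rewrite lee_fin.
Qed.

(** * Identifying weighted integrals from their values on indicators *)

Section weighted_integral.
Context {R : realType} {d : measure_display} {T : measurableType d}
  (mu : {measure set T -> \bar R}) {d' : measure_display}
  {Z : measurableType d'} (X : T -> Z) (W : T -> R).
Hypotheses (mX : measurable_fun setT X) (mW : measurable_fun setT W)
  (W0 : forall w, 0 <= W w).
Import HBNNSimple.

Lemma weighted_integral_nnsfun (h : {nnsfun Z >-> R}) :
  (\int[mu]_w (W w * h (X w))%:E =
   \sum_(y <- finmap.enum_fset (fset_set (range h)))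
     (y%:E * \int[mu]_w (W w * \1_(h @^-1` [set y]) (X w))%:E))%E.
Proof.
under eq_integral => w _.
  rewrite fimfunE fsbig_finite// mulr_sumr -sumEFin.
  over.
have mI (y : R) : measurable_fun setT
   (EFin \o (fun w => W w * \1_(h @^-1` [set y]) (X w))).
  apply/measurable_EFinP/measurable_funM => //.
  by apply: measurableT_comp => //; apply: measurable_indic.
have E (y : R) w : ((W w * (y * \1_(h @^-1` [set y]) (X w)))%:E =
   y%:E * (W w * \1_(h @^-1` [set y]) (X w))%:E)%E.
  by rewrite mulrCA EFinM.
have I0 (y : R) w : (0 <= y%:E * (W w * \1_(h @^-1` [set y]) (X w))%:E)%E.
  by rewrite -E lee_fin mulr_ge0// -lee_fin EFinM nnfun_muleindic_ge0.
rewrite ge0_integral_sum //.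
- apply: eq_big_seq => y; rewrite in_fset_set// inE => -[z _ yz].
  under eq_integral do rewrite E.
  rewrite ge0_integralZl//; last by rewrite lee_fin -yz.
    exact: mI.
  by move=> w _; rewrite lee_fin mulr_ge0.
- move=> y; under eq_fun do rewrite E.
  by apply: measurable_funeM; exact: mI.
- by move=> y w _; rewrite E.
Qed.

Lemma weighted_integral_lim (f : Z -> R) (f0 : forall z, 0 <= f z)
    (mEf : measurable_fun setT (EFin \o f)) :
  (\int[mu]_w (W w * f (X w))%:E =
  limn (fun n => \int[mu]_w
    (W w * nnsfun_approx measurableT mEf n (X w))%:E))%E.
Proof.
rewrite -monotone_convergence//=.
- apply: eq_integral => w _; apply/esym/cvg_lim => //.
  have -> : (fun n => (W w * nnsfun_approx measurableT mEf n (X w))%:E) =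
      (fun n => ((W w)%:E * (nnsfun_approx measurableT mEf n (X w))%:E))%E.
    by apply/funext => n; rewrite EFinM.
  rewrite EFinM; apply: cvgeZl => //.
  apply: (cvg_nnsfun_approx measurableT mEf) => //= z _; by rewrite lee_fin.
- move=> n; apply/measurable_EFinP/measurable_funM => //.
  exact: measurableT_comp.
- by move=> n w _; rewrite lee_fin mulr_ge0.
- move=> w _ m n mn; rewrite lee_fin ler_wpM2l//.
  by have := nd_nnsfun_approx measurableT mEf mn; move/lefP; exact.
Qed.

End weighted_integral.

Section eq_weighted_integral.
Import HBNNSimple.

(** Simple functions, then monotone limits. Two measure spaces and two weights are allowed because
    there are two uses: a product of independent factors against a constant weight, and a law
    against a Lebesgue density with the identity map. *)
Lemma eq_weighted_integral (R : realType) (d1 d2 d' : measure_display)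
    (T1 : measurableType d1) (T2 : measurableType d2) (Z : measurableType d')
    (mu1 : {measure set T1 -> \bar R}) (mu2 : {measure set T2 -> \bar R})
    (X1 : T1 -> Z) (X2 : T2 -> Z) (W1 : T1 -> R) (W2 : T2 -> R) :
  measurable_fun setT X1 -> measurable_fun setT X2 ->
  measurable_fun setT W1 -> measurable_fun setT W2 ->
  (forall w, 0 <= W1 w) -> (forall w, 0 <= W2 w) ->
  (forall A, measurable A ->
    \int[mu1]_w (W1 w * \1_A (X1 w))%:E =
    \int[mu2]_w (W2 w * \1_A (X2 w))%:E)%E ->
  forall f : Z -> R, measurable_fun setT f -> (forall z, 0 <= f z) ->
  (\int[mu1]_w (W1 w * f (X1 w))%:E = \int[mu2]_w (W2 w * f (X2 w))%:E)%E.
Proof.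
move=> mX1 mX2 mW1 mW2 W10 W20 H f mf f0.
have mEf : measurable_fun setT (EFin \o f) by exact/measurable_EFinP.
rewrite (weighted_integral_lim mu1 X1 W1 mX1 mW1 W10 f f0 mEf).
rewrite (weighted_integral_lim mu2 X2 W2 mX2 mW2 W20 f f0 mEf).
congr (limn _); apply/funext => n.
rewrite !weighted_integral_nnsfun//; apply: eq_bigr => y _.
congr (_ * _)%E; apply: H; rewrite -[X in measurable X]setTI.
exact: measurable_funP.
Qed.

End eq_weighted_integral.

(** * Independence *)

Lemma measurable_fun_prodr (R : realType) (d : measure_display)
    (T : measurableType d) (I : Type) (s : seq I) (Q : pred I)
    (f : I -> T -> R) :
  (forall i, measurable_fun setT (f i)) ->
  measurable_fun setT (fun w => \prod_(i <- s | Q i) f i w).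
Proof.
move=> mf; elim: s => [|i s IH].
  by under eq_fun do rewrite big_nil; exact: measurable_cst.
under eq_fun do rewrite big_cons; case: (Q i) => //; exact: measurable_funM.
Qed.

Lemma integral_indic_RV (R : realType) (d : measure_display)
    (T : measurableType d) (P : probability T R) (X : {RV P >-> R})
    (A : set R) : measurable A ->
  (\int[P]_w (\1_A (X w) : R)%:E = P (X @^-1` A))%E.
Proof.
move=> mA; have mXA : measurable (X @^-1` A).
  by rewrite -[X in measurable X]setTI; exact: measurable_funP.
have := integral_indic P measurableT mXA; rewrite /= setIT; exact.
Qed.

Lemma independent_indicator (R : realType) (d : measure_display)
    (T : measurableType d) (P : probability T R) (D : nat)
    (X : 'I_D -> {RV P >-> R}) (A : 'I_D -> set R) :
  mutually_independent X -> (forall i, measurable (A i)) ->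
  (\int[P]_w (\prod_i \1_(A i) (X i w) : R)%:E =
   \prod_i P (X i @^-1` A i))%E.
Proof.
move=> indep mA.
have -> : (fun w => (\prod_i \1_(A i) (X i w) : R)%:E) =
    (fun w => (\1_(\bigcap_(i in [set` [set: 'I_D]%SET]) (X i @^-1` A i)) w : R)%:E).
  apply/funext => w; congr (_%:E); rewrite indicE.
  have [all|/existsNP[i iA]] := pselect (forall i, A i (X i w)).
    rewrite mem_set; last by move=> i _; exact: all.
    by rewrite big1// => i _; rewrite indicE mem_set.
  rewrite memNset; last by move=> /(_ i); apply: contra_not iA; apply => /=; rewrite inE.
  by rewrite (bigD1 i)//= indicE memNset// mul0r.
rewrite integral_indic//; last first.
  apply: fin_bigcap_measurable => // i _.
  by rewrite -[X in measurable X]setTI; exact: measurable_funP.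
rewrite setIT; have /= -> := indep [set: 'I_D]%SET A mA.
by apply: eq_bigl => i; rewrite inE.
Qed.

(** Indicators are traded for general functions one coordinate at a time: in the induction, the
    functions of index at least [n] are still indicators. At 0 this is independence of events, at
    [D] there is no restriction left. *)
Lemma independent_prod (R : realType) (d : measure_display)
    (T : measurableType d) (P : probability T R) (D : nat)
    (X : 'I_D -> {RV P >-> R}) (g : 'I_D -> R -> R) (c : 'I_D -> R) :
  mutually_independent X ->
  (forall i, measurable_fun setT (g i)) -> (forall i x, 0 <= g i x) ->
  (forall i, (\int[P]_w (g i (X i w))%:E = (c i)%:E)%E) ->
  (\int[P]_w (\prod_i g i (X i w))%:E = (\prod_i c i)%:E)%E.
Proof.
move=> indep.
suff H n : forall (g : 'I_D -> R -> R) (c : 'I_D -> R),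
  (forall i : 'I_D, (n <= i)%N -> exists2 A, measurable A & g i = \1_A) ->
  (forall i, measurable_fun setT (g i)) -> (forall i x, 0 <= g i x) ->
  (forall i, (\int[P]_w (g i (X i w))%:E = (c i)%:E)%E) ->
  (\int[P]_w (\prod_i g i (X i w))%:E = (\prod_i c i)%:E)%E.
  apply: (H D) => i; by rewrite leqNgt ltn_ord.
move=> {g c}; elim: n => [|n IH] g c gA mg g0 gc.
  have /choice[A HA] : forall i, exists A, measurable A /\ g i = \1_A.
    by move=> i; have [A mA gE] := gA i (leq0n _); exists A.
  have mA i : measurable (A i) by have [] := HA i.
  have gE i : g i = \1_(A i) by have [] := HA i.
  transitivity (\int[P]_w (\prod_i \1_(A i) (X i w) : R)%:E)%E.
    apply: eq_integral => w _; congr (_%:E).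
    by apply: eq_bigr => i _; rewrite gE.
  rewrite independent_indicator// -prodEFin; apply: eq_bigr => i _.
  by rewrite -gc gE integral_indic_RV.
have [Dn|nD] := leqP D n.
  apply: IH => // i ni; have := ltn_ord i; by rewrite ltnNge (leq_trans Dn).
pose k := Ordinal nD.
pose W w := \prod_(i | i != k) g i (X i w).
pose C := \prod_(i | i != k) c i.
have mW : measurable_fun setT W.
  by apply: measurable_fun_prodr => i; exact: measurableT_comp.
have W0 w : 0 <= W w by rewrite prodr_ge0.
have c0 i : 0 <= c i.
  by rewrite -lee_fin -gc; apply: integral_ge0 => w _; rewrite lee_fin.
have C0 : 0 <= C by rewrite prodr_ge0.
(* With an indicator in position [k] the induction hypothesis applies, so the weight [W] of the
   other coordinates acts on events of [X k] like the constant [C]. *)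
have step (A : set R) : measurable A ->
    (\int[P]_w (W w * \1_A (X k w))%:E = \int[P]_w (C * \1_A (X k w))%:E)%E.
  move=> mA.
  pose g' i := if i == k then \1_A else g i.
  pose c' i := if i == k then fine (P (X k @^-1` A)) else c i.
  have mXA : measurable (X k @^-1` A).
    by rewrite -[X in measurable X]setTI; exact: measurable_funP.
  have iXA : (\int[P]_w (\1_A (X k w) : R)%:E = P (X k @^-1` A))%E.
    exact: integral_indic_RV.
  have := IH g' c'.
  rewrite (bigD1 k)//= /c' eqxx (eq_bigr c); last by move=> i /negPf ->.
  under eq_integral.
    move=> w _; rewrite (bigD1 k)//= /g' eqxx.
    rewrite (eq_bigr (fun i => g i (X i w))); last by move=> i /negPf ->.
    rewrite mulrC; over.
  move=> ->.
  - under eq_integral do rewrite EFinM.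
    rewrite ge0_integralZl//.
    + by rewrite iXA mulrC EFinM fineK// fin_num_measure.
    + by apply/measurable_EFinP; exact: measurableT_comp.
  - move=> i ni; rewrite /g'; have [_|ik] := eqVneq i k; first by exists A.
    apply: gA; rewrite ltn_neqAle ni andbT.
    by apply: contra ik => /eqP e; apply/eqP/val_inj.
  - by move=> i; rewrite /g'; case: ifP.
  - by move=> i x; rewrite /g'; case: ifP.
  - move=> i; rewrite /g'; have [->|//] := eqVneq i k.
    by rewrite iXA fineK// fin_num_measure.
transitivity (\int[P]_w (W w * g k (X k w))%:E)%E.
  by apply: eq_integral => w _; rewrite (bigD1 k)//= mulrC.
rewrite (eq_weighted_integral _ _ _ _ _ _ _ P P (X k) (X k) W (cst C))//=.
under eq_integral do rewrite EFinM.
rewrite ge0_integralZl//.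
- by rewrite gc -EFinM (bigD1 k)//= mulrC.
- by apply/measurable_EFinP; exact: measurableT_comp.
- by move=> w _; rewrite lee_fin.
Qed.
(** * Gaussian moment bounds *)

Lemma integral_standard_normal (R : realType) (d : measure_display)
    (T : measurableType d) (P : probability T R) (X : {RV P >-> R})
    (f : R -> R) :
  standard_normal X -> measurable_fun setT f -> (forall x, 0 <= f x) ->
  (\int[P]_w (f (X w))%:E =
   \int[@lebesgue_measure R]_x (normal_pdf 0 1 x * f x)%:E)%E.
Proof.
move=> nX mf f0.
transitivity (\int[P]_w (1 * f (X w))%:E)%E.
  by apply: eq_integral => w _; rewrite mul1r.
apply: (eq_weighted_integral _ _ _ _ _ _ _ P (@lebesgue_measure R)
  X idfun (cst 1) (normal_pdf 0 1)) => //=.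
- exact: measurable_id.
- exact: measurable_normal_pdf.
- by move=> x; exact: normal_pdf_ge0.
move=> A mA; under eq_integral do rewrite mul1r.
rewrite integral_indic_RV//; have := nX A mA.
rewrite /distribution /pushforward /= => ->.
rewrite /normal_prob integral_mkcond; apply: eq_integral => x _.
rewrite patchE indicE; case: ifP => _; by rewrite ?mulr1 ?mulr0.
Qed.

(* Completing the square turns the integrand into a multiple of the density of
   the normal law with mean q / (1 - 2p) and variance 1 / (1 - 2p). *)
Lemma integral_expR_quadratic_normal (R : realType) (d : measure_display)
    (T : measurableType d) (P : probability T R) (X : {RV P >-> R})
    (p q r : R) :
  standard_normal X -> p < 2^-1 ->
  (\int[P]_w (expR (p * X w ^+ 2 + q * X w + r))%:E =
   ((Num.sqrt (1 - 2 * p))^-1 *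
     expR (r + q ^+ 2 / (2 * (1 - 2 * p))))%:E)%E.
Proof.
move=> nX p2; have v0 : 0 < 1 - 2 * p by lra.
pose f x : R := expR (p * x ^+ 2 + q * x + r).
have mf : measurable_fun setT f.
  apply: measurableT_comp => //; apply: measurable_funD => //.
  apply: measurable_funD; last exact: measurable_funM.
  by apply: measurable_funM => //; exact: measurable_funX.
rewrite (integral_standard_normal _ _ _ _ _ f)//; last first.
  by move=> x; exact: expR_ge0.
set c := (_ * expR _ : R).
set v := 1 - 2 * p in v0 *.
pose s : R := (Num.sqrt v)^-1.
have s0 : 0 < s by rewrite invr_gt0 sqrtr_gt0.
have s2 : s ^+ 2 = v^-1 by rewrite exprVn sqr_sqrtr// ltW.
have pdfE x : normal_pdf 0 1 x * f x = c * normal_pdf (q / v) s x.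
  rewrite !normal_pdfE ?oner_neq0 ?gt_eqF// /f /c /normal_peak /normal_fun s2.
  have -> : (Num.sqrt (v^-1 * pi *+ 2))^-1 =
            Num.sqrt v * (Num.sqrt (1 ^+ 2 * pi *+ 2))^-1 :> R.
    rewrite -mulrnAr sqrtrM ?invr_ge0 ?ltW// invfM; congr (_ * _).
      by rewrite sqrtrV ?ltW// invrK.
    by rewrite expr1n mul1r.
  set K := (Num.sqrt _)^-1.
  rewrite -[LHS]mulrA -expRD.
  transitivity (K * (expR (r + q ^+ 2 / (2 * v)) *
     expR (- (x - q / v) ^+ 2 / (v^-1 *+ 2)))); last first.
    have : Num.sqrt v != 0 by rewrite gt_eqF// sqrtr_gt0.
    move: (Num.sqrt v) => u u0; by field.
  rewrite -expRD; congr (_ * expR _).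
  rewrite /v; field; by rewrite -/v gt_eqF.
under eq_integral do rewrite pdfE EFinM.
have c0 : 0 <= c by rewrite mulr_ge0 ?expR_ge0// invr_ge0.
rewrite ge0_integralZl//.
- by rewrite integral_normal_pdf mule1.
- by apply/measurable_EFinP; exact: measurable_normal_pdf.
- by move=> x _; rewrite lee_fin; exact: normal_pdf_ge0.
Qed.
(** After squaring and using exp x >= 1 + x, the claim is (1 - 2p)(1 + 2p + 8p^2) = 1 + 4p^2 (1 -
    4p) >= 1, which is where p <= 1/4 enters. *)
Lemma invsqrt_le_expR (R : realType) (p : R) : `|p| <= 4^-1 ->
  (Num.sqrt (1 - 2 * p))^-1 <= expR (p + 4 * p ^+ 2).
Proof.
rewrite ler_norml => /andP[p1 p2]; have v0 : 0 < 1 - 2 * p by lra.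
rewrite -sqrtrV; last exact: ltW.
have -> : expR (p + 4 * p ^+ 2) = Num.sqrt (expR (2 * p + 8 * p ^+ 2)).
  rewrite -[LHS]ger0_norm ?expR_ge0// -sqrtr_sqr -expRM_natr.
  by congr (Num.sqrt (expR _)); ring.
rewrite ler_sqrt ?expR_gt0// -[leLHS]mul1r ler_pdivrMr// mulrC.
apply: le_trans (ler_wpM2l (ltW v0) (expR_ge1Dx _)).
by have := sqr_ge0 p; nra.
Qed.

(** The bound travels with the measurability and the sign that allow such bounds to be added, scaled
    and summed; all dominating functions are assembled in this form. *)
Definition mean_le (R : realType) (d : measure_display)
    (T : measurableType d) (P : probability T R) (F : T -> R) (c : R) :=
  [/\ measurable_fun setT F, forall w, 0 <= F w &
    (\int[P]_w (F w)%:E <= c%:E)%E].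

Section mean_le.
Context {R : realType} {d : measure_display} {T : measurableType d}
  (P : probability T R).
Implicit Types (F G : T -> R) (c e k : R).

Lemma mean_le_cst c : 0 <= c -> mean_le R d T P (fun=> c) c.
Proof.
move=> c0; split => //; rewrite integral_cst//=.
by rewrite probability_setT mule1.
Qed.

Lemma mean_leD F G c e : mean_le R d T P F c -> mean_le R d T P G e ->
  mean_le R d T P (fun w => F w + G w) (c + e).
Proof.
move=> [mF F0 Fc] [mG G0 Ge]; split.
- exact: measurable_funD.
- by move=> w; rewrite addr_ge0.
under eq_integral do rewrite EFinD.
rewrite ge0_integralD//.
- by rewrite EFinD leeD.
- by move=> w _; rewrite lee_fin.
- exact/measurable_EFinP.
- by move=> w _; rewrite lee_fin.
- exact/measurable_EFinP.
Qed.

Lemma mean_leZ k F c : 0 <= k -> mean_le R d T P F c ->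
  mean_le R d T P (fun w => k * F w) (k * c).
Proof.
move=> k0 [mF F0 Fc]; split.
- exact: measurable_funM.
- by move=> w; rewrite mulr_ge0.
under eq_integral do rewrite EFinM.
rewrite ge0_integralZl//.
- by rewrite EFinM lee_wpmul2l.
- exact/measurable_EFinP.
- by move=> w _; rewrite lee_fin.
Qed.

Lemma mean_le_sum (I : Type) (s : seq I) (F : I -> T -> R) (c : I -> R) :
  (forall i, mean_le R d T P (F i) (c i)) ->
  mean_le R d T P (fun w => \sum_(i <- s) F i w) (\sum_(i <- s) c i).
Proof.
move=> H; elim: s => [|i s IH].
  under eq_fun do rewrite big_nil; rewrite big_nil; exact: mean_le_cst.
under eq_fun do rewrite big_cons; rewrite big_cons; exact: mean_leD.
Qed.

Lemma mean_leW F c e : c <= e -> mean_le R d T P F c -> mean_le R d T P F e.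
Proof.
by move=> ce [mF F0 Fc]; split => //; rewrite (le_trans Fc)// lee_fin.
Qed.

(** The integral of a nonnegative function is a supremum over simple functions below it, so
    domination by a measurable [G] is enough. The loss at the random time can thus be bounded
    without studying [tau] as a function of the observation. *)
Lemma expectation_mean_le F G c : (forall w, 0 <= F w) ->
  (forall w, F w <= G w) -> mean_le R d T P G c -> ('E_P[F] <= c%:E)%E.
Proof.
move=> F0 FG [mG G0 Gc].
by apply: le_trans (le_expectation_ge0 _ _ _ P _ _ F0 FG) _; rewrite unlock.
Qed.

End mean_le.

(** The extra [eps j w ^+ 2 / 8] attaches a moment of one coordinate to a Chernoff bound. Together
    with [|s| <= 1/8] it keeps each quadratic coefficient at most 1/4, so the Gaussian integrals are
    finite and [invsqrt_le_expR] applies. *)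
Lemma mean_le_expR_noncentral_chi2 (R : realType) (d : measure_display)
    (T : measurableType d) (P : probability T R) (D : nat)
    (eps : 'I_D -> {RV P >-> R}) (a x : 'I_D -> R) (s : R) (j : 'I_D) :
  mutually_independent eps -> (forall i, standard_normal (eps i)) ->
  (forall i, 0 <= a i <= 1) -> `|s| <= 8^-1 ->
  mean_le R d T P
    (fun w => expR (s * (\sum_i a i * (x i + eps i w) ^+ 2) + eps j w ^+ 2 / 8))
    (expR (s * (\sum_i a i) + s * (\sum_i a i * x i ^+ 2) +
      4 * s ^+ 2 * D%:R + 4 * s ^+ 2 * (\sum_i a i * x i ^+ 2) + 1)).
Proof.
move=> indep nor a01; rewrite ler_norml => /andP[s1 s2].
pose dl (i : 'I_D) : R := (i == j)%:R.
pose p i := s * a i + dl i / 8.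
pose q i := 2 * s * a i * x i.
pose r i := s * a i * x i ^+ 2.
pose g i (e : R) := expR (p i * e ^+ 2 + q i * e + r i).
pose c i := (Num.sqrt (1 - 2 * p i))^-1 *
     expR (r i + q i ^+ 2 / (2 * (1 - 2 * p i))).
have gE w : expR (s * (\sum_i a i * (x i + eps i w) ^+ 2) + eps j w ^+ 2 / 8) =
    \prod_i g i (eps i w).
  rewrite -expR_sum; congr expR.
  have -> : eps j w ^+ 2 / 8 = \sum_i dl i / 8 * eps i w ^+ 2.
    rewrite (bigD1 j)//= /dl eqxx big1 ?addr0; last first.
      by move=> i /negPf ->; rewrite !mul0r.
    by rewrite mul1r mulrC.
  rewrite mulr_sumr -big_split/=; apply: eq_bigr => i _.
  by rewrite /p /q /r; ring.
have dl01 i : dl i = 0 \/ dl i = 1 by rewrite /dl; case: eqP; [right|left].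
have sa i : - 8^-1 <= s * a i <= 8^-1.
  have /andP[a0 a1] := a01 i; by apply/andP; split; nra.
have p14 i : - 8^-1 <= p i <= 4^-1.
  by have /andP[sa1 sa2] := sa i; rewrite /p; case: (dl01 i) => ->;
    apply/andP; split; lra.
have mg i : measurable_fun setT (g i).
  apply: measurableT_comp => //; apply: measurable_funD => //.
  apply: measurable_funD; last exact: measurable_funM.
  by apply: measurable_funM => //; exact: measurable_funX.
have gc i : (\int[P]_w (g i (eps i w))%:E = (c i)%:E)%E.
  apply: integral_expR_quadratic_normal => //.
  have /andP[] := p14 i; lra.
split.
- under eq_fun do rewrite gE.
  by apply: measurable_fun_prodr => i; exact: measurableT_comp.
- by move=> w; exact: expR_ge0.
under eq_integral do rewrite gE.
rewrite (independent_prod _ _ _ _ _ _ g c)//; last by move=> i y; exact: expR_ge0.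
rewrite lee_fin.
pose u i := s * a i + s * (a i * x i ^+ 2) + 4 * s ^+ 2 +
  4 * s ^+ 2 * (a i * x i ^+ 2) + dl i.
have cu i : 0 <= c i <= expR (u i).
  have /andP[p1 p2] := p14 i; have /andP[a0 a1] := a01 i.
  have /andP[sa1 sa2] := sa i.
  rewrite mulr_ge0 ?invr_ge0 ?sqrtr_ge0 ?expR_ge0//=.
  have p4 : `|p i| <= 4^-1 by rewrite ler_norml; apply/andP; split; lra.
  apply: le_trans (ler_wpM2r (expR_ge0 _) (invsqrt_le_expR _ _ p4)) _.
  rewrite -expRD ler_expR.
  (* For i = j the shift by 1/8 adds s a_i + 3/16, at most 5/16, which is rounded up to 1. *)
  have h1 : p i + 4 * p i ^+ 2 <= s * a i + 4 * s ^+ 2 + dl i.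
    have : (s * a i) ^+ 2 <= s ^+ 2.
      by rewrite exprMn -[leRHS]mulr1 ler_wpM2l ?sqr_ge0// expr_le1.
    by rewrite /p; case: (dl01 i) => ->; nra.
  have h2 : q i ^+ 2 / (2 * (1 - 2 * p i)) <= 4 * s ^+ 2 * (a i * x i ^+ 2).
    have v1 : 1 <= 2 * (1 - 2 * p i) by lra.
    rewrite ler_pdivrMr; last lra.
    have -> : q i ^+ 2 = 4 * s ^+ 2 * (a i * x i ^+ 2) * a i by rewrite /q; ring.
    apply: ler_wpM2l; last lra.
    by apply: mulr_ge0; apply: mulr_ge0; rewrite ?sqr_ge0.
  by rewrite /u /r -mulrA; lra.
apply: (@le_trans _ _ (\prod_i expR (u i))).
  by apply: ler_prod => i _; exact: cu.
rewrite -expR_sum ler_expR /u !big_split/= -!mulr_sumr.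
have -> : \sum_i dl i = 1.
  by rewrite (bigD1 j)//= /dl eqxx big1 ?addr0// => i /negPf ->.
by rewrite sumr_const card_ord -[_ *+ D]mulr_natr; lra.
Qed.
(** * The Landweber filter *)

Section landweber.
Context {R : realType}.
Implicit Types (t u l : R).

Local Notation g := (@landweber R).

(** With [min] and [max] both branches become one expression, so continuity and monotonicity need no
    gluing at t = 1; for t <= 1 the last two terms cancel. *)
Lemma landweberE t l : 0 < l <= 1 ->
  g t l = (Num.min t 1 * l) ^+ 2 + (1 - l ^+ 2) -
          (1 - l ^+ 2) `^ (Num.max t 1 ^+ 2).
Proof.
move=> /andP[l0 l1]; have l2 : 0 <= 1 - l ^+ 2 by nra.
rewrite /landweber; case: (leP t 1) => [t1|t1].
  by rewrite expr1n powRr1//; ring.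
by rewrite mul1r; ring.
Qed.

Lemma landweber0 l : g 0 l = 0.
Proof. by rewrite /landweber ler01 mul0r expr0n. Qed.

Lemma continuous_landweber l : 0 < l <= 1 -> continuous (g^~ l).
Proof.
move=> l01.
pose a t := (Num.min t 1 * l) ^+ 2 + (1 - l ^+ 2).
pose b t := (1 - l ^+ 2) `^ (Num.max t 1 ^+ 2).
have -> : g^~ l = a - b by apply/funext => t; exact: landweberE.
have cX (f : R -> R) : continuous f -> continuous (fun t => f t ^+ 2).
  move=> cf; have -> : (fun t => f t ^+ 2) = f \* f by apply/funext => t.
  by move=> t; exact: cvgM (cf t) (cf t).
have cmin : continuous (fun t : R => Num.min t 1).
  move=> t; apply: continuous_min; [exact: cvg_id|exact: cvg_cst].
have cmax : continuous (fun t : R => Num.max t 1).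
  move=> t; apply: continuous_max; [exact: cvg_id|exact: cvg_cst].
have ca : continuous a.
  have c1 : continuous (fun t : R => (Num.min t 1 * l) ^+ 2).
    apply: cX; move=> t; exact: cvgM (cmin t) (@cvg_cst _ _ _ _ _).
  by move=> t; exact: cvgD (c1 t) (@cvg_cst _ _ _ _ _).
have cb : continuous b.
  (* At l = 1 the base is 0. The exponent stays at least 1, so the value of 0 to the power 0 never
     occurs and this term is constantly 0. *)
  have max_neq0 v : Num.max v 1 ^+ 2 != 0 :> R.
    by rewrite expf_eq0/= gt_eqF// lt_max ltr01 orbT.
  rewrite /b; have [->|l2] := eqVneq (1 - l ^+ 2) 0.
    under eq_fun do rewrite powR0//.
    by move=> t; exact: cvg_cst.
  have -> : (fun t => (1 - l ^+ 2) `^ (Num.max t 1 ^+ 2)) =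
     @expR R \o (fun t => Num.max t 1 ^+ 2 * ln (1 - l ^+ 2)).
    by apply/funext => t; rewrite /powR (negPf l2).
  move=> t; apply: (@continuous_comp R R R); last exact: continuous_expR.
  exact: cvgM (cX _ cmax t) (@cvg_cst _ _ _ _ _).
by move=> t; exact: cvgB (ca t) (cb t).
Qed.

Lemma le_landweber t u l : 0 < l <= 1 -> 0 <= t <= u -> g t l <= g u l.
Proof.
move=> l01 /andP[t0 tu]; rewrite !landweberE//; have /andP[l0 l1] := l01.
have l2 : 0 <= 1 - l ^+ 2 <= 1 by apply/andP; split; nra.
apply: lerB.
  rewrite lerD2r; apply: lerXn2r; rewrite ?nnegrE.
  - by apply: mulr_ge0; [rewrite le_min t0 ler01|exact: ltW].
  - by apply: mulr_ge0; [rewrite le_min (le_trans t0 tu) ler01|exact: ltW].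
  by apply: ler_wpM2r; [exact: ltW|rewrite le_min !ge_min tu lexx !orbT].
have tu2 : Num.max t 1 ^+ 2 <= Num.max u 1 ^+ 2.
  by apply: lerXn2r; rewrite ?nnegrE ?ge_max !le_max ?ler01 ?tu ?lexx !orbT.
have max_neq0 v : Num.max v 1 ^+ 2 != 0 :> R.
  by rewrite expf_eq0/= gt_eqF// lt_max ltr01 orbT.
have [->|l2n] := eqVneq (1 - l ^+ 2) 0; first by rewrite !powR0.
have /andP[l20 l21] := l2.
by apply: ger_powR => //; rewrite lt_neqAle eq_sym l2n l20.
Qed.

Lemma landweber_ge0 t l : 0 < l <= 1 -> 0 <= t -> 0 <= g t l.
Proof. by move=> l01 t0; rewrite -(landweber0 l) le_landweber// lexx. Qed.

Lemma landweber_le1 t l : 0 < l <= 1 -> 0 <= t -> g t l <= 1.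
Proof.
move=> l01 t0; rewrite /landweber; case: ifP => [t1|_].
  by have /andP[l0 l1] := l01; apply: exprn_ile1; nra.
by rewrite lerBlDr lerDl powR_ge0.
Qed.

Lemma powR1B_le (x a : R) : 0 <= x <= 1 -> 0 < a ->
  (1 - x) `^ a <= expR (- (a * x)).
Proof.
move=> /andP[x0 x1] a0.
have -> : expR (- (a * x)) = expR (- x) `^ a.
  by rewrite -expRM; congr expR; ring.
apply: ge0_ler_powR; rewrite ?nnegrE ?expR_ge0//; [lra|lra|].
by apply: le_trans (expR_ge1Dx _); lra.
Qed.

Lemma powR1B_ge (x a : R) : 0 <= x <= 2^-1 -> 0 < a ->
  expR (- (a * (2 * x))) <= (1 - x) `^ a.
Proof.
move=> /andP[x0 x1] a0.
have -> : expR (- (a * (2 * x))) = expR (- (2 * x)) `^ a.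
  by rewrite -expRM; congr expR; ring.
apply: ge0_ler_powR; rewrite ?nnegrE ?expR_ge0//; [lra|lra|].
rewrite expRN -[leLHS]mul1r ler_pdivrMr ?expR_gt0//.
apply: le_trans (ler_wpM2l _ (expR_ge1Dx _)); last lra.
nra.
Qed.

Lemma expRN_le (y : R) : 0 <= y -> expR (- y) <= 1 - Num.min y 1 / 2.
Proof.
move=> y0; wlog y1 : y y0 / y <= 1.
  move=> H; have [y1|] := boolP (y <= 1); first exact: H.
  rewrite -ltNge => /ltW y1.
  rewrite (min_r y1); apply: le_trans (_ : expR (- 1) <= _).
    by rewrite ler_expR lerN2.
  by have := H 1 ler01 (lexx _); rewrite minxx.
rewrite (min_l y1) expRN -[leLHS]mul1r ler_pdivrMr ?expR_gt0//.
apply: le_trans (ler_wpM2l _ (expR_ge1Dx _)); last lra.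
nra.
Qed.

(** [Num.min ((t * l) ^+ 2) 1] is a model of the filter, correct up to a factor 2 on each side,
    whose behaviour under scaling of t is explicit. The variance estimates are carried out on this
    model. *)
Lemma landweber_lower t l : 0 < l <= 1 -> 0 <= t ->
  Num.min ((t * l) ^+ 2) 1 / 2 <= g t l.
Proof.
move=> l01 t0; have /andP[l0 l1] := l01; rewrite /landweber; case: ifPn => t1.
  have := sqr_ge0 (t * l); move: ((t * l) ^+ 2) => y y0.
  by have : Num.min y 1 <= y; [rewrite ge_min lexx|lra].
rewrite -ltNge in t1; have := @powR1B_le (l ^+ 2) (t ^+ 2).
have -> : t ^+ 2 * l ^+ 2 = (t * l) ^+ 2 by ring.
move=> H; have {}H : (1 - l ^+ 2) `^ (t ^+ 2) <= expR (- (t * l) ^+ 2).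
  by apply: H; [apply/andP; split|]; nra.
have := expRN_le _ (sqr_ge0 (t * l)); lra.
Qed.

Lemma landweber_upper t l : 0 < l <= 1 -> 0 <= t ->
  g t l <= 2 * Num.min ((t * l) ^+ 2) 1.
Proof.
move=> l01 t0; have /andP[l0 l1] := l01.
have [tl1|tl1] := leP ((t * l) ^+ 2) 1; last first.
  by apply: le_trans (landweber_le1 _ _ l01 t0) _; lra.
have y0 := sqr_ge0 (t * l).
rewrite /landweber; case: ifPn => [|t1]; first lra.
rewrite -ltNge in t1.
have [l2|l2] := leP (l ^+ 2) 2^-1.
  have := @powR1B_ge (l ^+ 2) (t ^+ 2).
  have -> : t ^+ 2 * (2 * l ^+ 2) = 2 * (t * l) ^+ 2 by ring.
  move=> H; have {}H : expR (- (2 * (t * l) ^+ 2)) <= (1 - l ^+ 2) `^ (t ^+ 2).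
    by apply: H; [apply/andP; split|]; nra.
  have := expR_ge1Dx (- (2 * (t * l) ^+ 2)); lra.
have : 1 <= 2 * (t * l) ^+ 2 by rewrite exprMn; nra.
have := powR_ge0 (1 - l ^+ 2) (t ^+ 2); lra.
Qed.

(* The exponential saturation of Landweber iteration: between T and u >= 2T
   each coordinate loses a factor of order 1 / (u l). *)
Lemma landweber_decay t u l : 0 < l <= 1 -> 0 <= t -> 0 < u -> 2 * t <= u ->
  l ^+ 2 * (1 - g u l) ^+ 2 <= 4 / u ^+ 2 * (1 - g t l) ^+ 2.
Proof.
move=> l01 t0 u0 tu; have /andP[l0 l1] := l01.
have gu1 := landweber_le1 u l l01 (ltW u0).
have gtu : g t l <= g u l by apply: le_landweber => //; apply/andP; split; lra.
have [u2|u2] := leP u 2.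
  apply: (@le_trans _ _ (4 / u ^+ 2 * (1 - g u l) ^+ 2)).
    apply: ler_wpM2r; first exact: sqr_ge0.
    rewrite ler_pdivlMr ?exprn_gt0// -exprMn.
    have : l * u <= 2 by nra.
    have : 0 <= l * u by rewrite mulr_ge0// ltW.
    by move: (l * u) => x; nra.
  apply: ler_wpM2l; first by rewrite divr_ge0// sqr_ge0.
  by apply: lerXn2r; rewrite ?nnegrE; lra.
pose s := Num.max t 1.
have s1 : 1 <= s by rewrite le_max lexx orbT.
have ts : t <= s by rewrite le_max lexx.
have su : 2 * s <= u by rewrite /s; case: (leP t 1) => _; lra.
have gs1 : g s l <= 1 by apply: landweber_le1 => //; lra.
have gts : g t l <= g s l by apply: le_landweber => //; rewrite t0.
have gE v : 1 <= v -> 1 - g v l = (1 - l ^+ 2) `^ (v ^+ 2).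
  move=> v1; rewrite landweberE// (min_r v1) (max_l v1) mul1r; ring.
apply: (@le_trans _ _ (4 / u ^+ 2 * (1 - g s l) ^+ 2)); last first.
  apply: ler_wpM2l; first by rewrite divr_ge0// sqr_ge0.
  by apply: lerXn2r; rewrite ?nnegrE; lra.
rewrite !gE//; last lra.
have l20 : 0 <= 1 - l ^+ 2 <= 1 by apply/andP; split; nra.
(* The exponent gained between [s] and [u]. As [s] is at most u/2, e >= 3u^2/4, and l^2 exp (- 2 e
   l^2) <= l^2 / (1 + 2 e l^2) <= 1 / (2e), which is below 4/u^2. *)
pose e := u ^+ 2 - s ^+ 2.
have e0 : 3 / 4 * u ^+ 2 <= e by rewrite /e; nra.
have -> : (1 - l ^+ 2) `^ (u ^+ 2) =
    (1 - l ^+ 2) `^ (s ^+ 2) * (1 - l ^+ 2) `^ e.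
  rewrite -powRD; last first.
    have : 0 < u ^+ 2 by rewrite exprn_gt0.
    by move=> u20; apply/implyP => /eqP; rewrite /e; lra.
  by congr (_ `^ _); rewrite /e; ring.
rewrite exprMn mulrCA [leRHS]mulrC; apply: ler_wpM2l; first exact: sqr_ge0.
have u20 : 0 < u ^+ 2 by rewrite exprn_gt0.
have h : (1 - l ^+ 2) `^ e <= expR (- (e * l ^+ 2)).
  by apply: powR1B_le; [apply/andP; split; nra|lra].
have h2 : l ^+ 2 * ((1 - l ^+ 2) `^ e) ^+ 2 <= l ^+ 2 * expR (- (2 * e * l ^+ 2)).
  apply: ler_wpM2l; first exact: sqr_ge0.
  have -> : expR (- (2 * e * l ^+ 2)) = expR (- (e * l ^+ 2)) ^+ 2.
    by rewrite -expRM_natr; congr expR; ring.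
  by apply: lerXn2r; rewrite ?nnegrE ?powR_ge0 ?expR_ge0.
apply: le_trans h2 _; rewrite expRN ler_pdivrMr ?expR_gt0//.
apply: le_trans (ler_wpM2l _ (expR_ge1Dx _)); last by rewrite divr_ge0// ltW.
have -> : 4 / u ^+ 2 * (1 + 2 * e * l ^+ 2) =
  4 / u ^+ 2 + l ^+ 2 * (8 * (e / u ^+ 2)) by field; lra.
have : 3 / 4 <= e / u ^+ 2 by rewrite ler_pdivlMr.
have : 0 < 4 / u ^+ 2 by rewrite divr_gt0.
by have := sqr_ge0 l; nra.
Qed.

End landweber.

(** * Weak and strong variances *)

Section spectrum.
(** [M] and [q] stand for L^(1/nu_-) and L^(-1/nu_+). Indices start at 0: dividing the one-based
    index i + 1 by [L] and rounding up lands on the zero-based [i %/ L], rounding down on the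
    predecessor of [i.+1 %/ L]. *)
Context {R : realType} {D : nat} (L : nat) (M q : R) (la : 'I_D -> R).
Hypotheses (L2 : (2 <= L)%N) (M0 : 0 < M) (q0 : 0 <= q)
  (q1 : q ^+ 2 * L%:R < 1) (la01 : forall i, 0 < la i <= 1)
  (la_dec : forall i j : 'I_D, (i <= j)%N -> la j <= la i)
  (la_lo : forall i j : 'I_D, j = (i %/ L)%N :> nat -> la j <= M * la i)
  (la_hi : forall i j : 'I_D, j.+1 = (i.+1 %/ L)%N -> la i <= q * la j).
Implicit Types (t W : R) (i j : 'I_D).

Local Notation g := (@landweber R).
Let h t i : R := Num.min ((t * la i) ^+ 2) 1.

Definition weak_var (t : R) : R := \sum_i g t (la i) ^+ 2.
Definition strong_var (t : R) : R := \sum_i g t (la i) ^+ 2 / la i ^+ 2.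

Let L0 : (0 < L)%N. Proof. exact: leq_trans L2. Qed.

Let h01 t i : 0 <= h t i <= 1.
Proof. by rewrite le_min sqr_ge0 ler01 ge_min lexx orbT. Qed.

Let g_h t i : 0 <= t -> h t i / 2 <= g t (la i) <= 2 * h t i.
Proof. by move=> t0; rewrite landweber_lower// landweber_upper. Qed.

Let g01 t i : 0 <= t -> 0 <= g t (la i) <= 1.
Proof. by move=> t0; rewrite landweber_ge0// landweber_le1. Qed.

Let la0 i : 0 < la i. Proof. by have /andP[] := la01 i. Qed.

Let laW i : 0 <= la i. Proof. exact: ltW. Qed.

Let card_divn_fiber (c : nat) :
  (#|[pred i : 'I_D | (i.+1 %/ L == c)%N]| <= L)%N.
Proof.
pose f (i : 'I_D) : 'I_L := Ordinal (ltn_pmod i.+1 L0).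
rewrite -[leqRHS]card_ord -(@card_in_image _ _ f); first exact: max_card.
move=> i j; rewrite !inE => /eqP ic /eqP jc /(congr1 val)/= ij.
apply: val_inj; apply: succn_inj.
by rewrite (divn_eq i.+1 L) (divn_eq j.+1 L) ic jc ij.
Qed.

(* Each h_k with k >= L is at most q^2 h + h^2 at index k / L, and every index
   is hit at most L times; since q^2 L < 1 the linear sum can be absorbed. *)
Let sum_min_le t : 0 <= t ->
  (1 - q ^+ 2 * L%:R) * (\sum_i h t i) <=
  L%:R + L%:R * \sum_i h t i ^+ 2.
Proof.
move=> t0; pose y j := q ^+ 2 * h t j + h t j ^+ 2.
have y0 j : 0 <= y j.
  have /andP[hj0 _] := h01 t j.
  by apply: addr_ge0; rewrite ?sqr_ge0// mulr_ge0// sqr_ge0.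
have key i : h t i <= ((i.+1 < L)%N : nat)%:R +
    \sum_(j : 'I_D | (i.+1 %/ L == j.+1)%N) y j.
  have /andP[hi0 hi1] := h01 t i.
  have S0 : 0 <= \sum_(j : 'I_D | (i.+1 %/ L == j.+1)%N) y j by apply: sumr_ge0.
  case: ltnP => iL; first by rewrite (le_trans hi1)// lerDl.
  rewrite add0r.
  have jL : (0 < i.+1 %/ L)%N by rewrite divn_gt0.
  have jD : ((i.+1 %/ L).-1 < D)%N.
    apply: leq_ltn_trans (ltn_ord i); rewrite -ltnS prednK//; exact: leq_div.
  pose j := Ordinal jD.
  have jE : j.+1 = (i.+1 %/ L)%N by rewrite /= prednK.
  rewrite (bigD1 j) ?jE//=; apply: (@le_trans _ _ (y j)); last first.
    by rewrite lerDl; apply: sumr_ge0.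
  have lai := la_hi _ _ jE.
  have hj1 : 0 <= (t * la j) ^+ 2 by exact: sqr_ge0.
  have hiE : h t i <= q ^+ 2 * (t * la j) ^+ 2.
    apply: (@le_trans _ _ ((t * la i) ^+ 2)); first by rewrite ge_min lexx.
    rewrite -exprMn; apply: lerXn2r; rewrite ?nnegrE ?mulr_ge0//.
    by rewrite mulrCA ler_wpM2l.
  have [tj|/ltW tj] := leP ((t * la j) ^+ 2) 1.
    have hj : h t j = (t * la j) ^+ 2 by rewrite /h min_l.
    by rewrite /y hj (le_trans hiE)// lerDl sqr_ge0.
  have hj : h t j = 1 by rewrite /h min_r.
  by rewrite /y hj expr1n mulr1 (le_trans hi1)// lerDr sqr_ge0.
have sumy : \sum_(i < D) \sum_(j : 'I_D | (i.+1 %/ L == j.+1)%N) y j <=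
    L%:R * \sum_j y j.
  rewrite (exchange_big_dep predT)//= mulr_sumr; apply: ler_sum => j _.
  rewrite (eq_bigl [in [pred i : 'I_D | (i.+1 %/ L == j.+1)%N]])//.
  rewrite sumr_const -[_ *+ _]mulr_natl; apply: ler_wpM2r => //.
  by rewrite ler_nat; exact: card_divn_fiber.
have sumL : \sum_(i < D) ((i.+1 < L)%N : nat)%:R <= L%:R :> R.
  rewrite -natr_sum ler_nat; apply: leq_trans (card_divn_fiber 0%N).
  rewrite -sum1_card [leqRHS]big_mkcond/=; apply: leq_sum => i _.
  by rewrite inE eqn0Ngt divn_gt0// -ltnNge; case: ltnP.
have H : \sum_i h t i <= \sum_(i < D) ((i.+1 < L)%N : nat)%:R +
    \sum_(i < D) \sum_(j : 'I_D | (i.+1 %/ L == j.+1)%N) y j.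
  by rewrite -big_split; apply: ler_sum => i _; exact: key.
have := le_trans H (lerD sumL sumy).
by rewrite /y big_split/= -mulr_sumr; lra.
Qed.

(** Since the model is at most twice the filter and the weak variance is at least 1, the right-hand
    side L + L sum h^2 is at most 5 L v; 20 leaves room. *)
Definition kA : R := 20 * L%:R / (1 - q ^+ 2 * L%:R).

Let qL0 : 0 < 1 - q ^+ 2 * L%:R. Proof. by rewrite subr_gt0. Qed.

Lemma kA_gt0 : 0 < kA.
Proof. by rewrite divr_gt0// mulr_gt0// ltr0n. Qed.

Let sum_min_le_weak_var t : 0 <= t -> 1 <= weak_var t ->
  \sum_i h t i <= kA * weak_var t.
Proof.
move=> t0 v1; have S := sum_min_le t t0.
have hv : \sum_i h t i ^+ 2 <= 4 * weak_var t.
  rewrite mulr_sumr; apply: ler_sum => i _.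
  have /andP[h0 _] := h01 t i; have /andP[gh _] := g_h t i t0; nra.
have Lr : 0 < L%:R :> R by rewrite ltr0n.
rewrite /kA mulrAC ler_pdivlMr// mulrC (le_trans S)//; nra.
Qed.

Lemma sum_landweber_le t : 0 <= t -> 1 <= weak_var t ->
  \sum_i g t (la i) <= 2 * kA * weak_var t.
Proof.
move=> t0 v1; have := sum_min_le_weak_var t t0 v1.
have : \sum_i g t (la i) <= 2 * \sum_i h t i.
  by rewrite mulr_sumr; apply: ler_sum => i _; have /andP[] := g_h t i t0.
lra.
Qed.

(** One of the two factors [h] in the squared filter pays for the division by [la i ^+ 2], being at
    most (t la_i)^2; the linear sum that remains is controlled by the weak variance. *)
Lemma strong_var_le_weak t : 0 <= t -> 1 <= weak_var t ->
  strong_var t <= 4 * kA * t ^+ 2 * weak_var t.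
Proof.
move=> t0 v1; have H := sum_min_le_weak_var t t0 v1.
apply: (@le_trans _ _ (4 * t ^+ 2 * \sum_i h t i)); last first.
  by have := ler_wpM2l (sqr_ge0 t) H; lra.
rewrite mulr_sumr; apply: ler_sum => i _.
rewrite ler_pdivrMr ?exprn_gt0//.
have /andP[h0 h1] := h01 t i; have /andP[_ gh] := g_h t i t0.
have /andP[g0 _] := g01 t i t0.
have hl : h t i <= (t * la i) ^+ 2 by rewrite ge_min lexx.
have -> : 4 * t ^+ 2 * h t i * la i ^+ 2 = 4 * h t i * (t * la i) ^+ 2 by ring.
apply: (@le_trans _ _ ((2 * h t i) ^+ 2)); last nra.
by apply: lerXn2r; rewrite ?nnegrE//; lra.
Qed.

(** The model grows by at most K^2 when time is multiplied by [K]; passing to the model and back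
    costs 4, and everything is squared. *)
Lemma strong_var_scale t (K : R) : 1 <= K -> 0 <= t ->
  strong_var (K * t) <= 16 * K ^+ 4 * strong_var t.
Proof.
move=> K1 t0; have Kt0 : 0 <= K * t by rewrite mulr_ge0//; lra.
rewrite mulr_sumr; apply: ler_sum => i _; rewrite mulrA.
apply: ler_wpM2r; first by rewrite invr_ge0 sqr_ge0.
have K2 : 1 <= K ^+ 2 by rewrite expr_ge1//; lra.
have hK : h (K * t) i <= K ^+ 2 * h t i.
  rewrite /h -mulrA exprMn; have := sqr_ge0 (t * la i).
  move: ((t * la i) ^+ 2) => z z0.
  by case: (leP z 1) => z1; rewrite ge_min; apply/orP; [left|right; lra].
have /andP[_ gh] := g_h (K * t) i Kt0; have /andP[g0 _] := g01 (K * t) i Kt0.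
have /andP[gh' _] := g_h t i t0.
have -> : 16 * K ^+ 4 * g t (la i) ^+ 2 = (4 * K ^+ 2 * g t (la i)) ^+ 2 by ring.
have /andP[g0' _] := g01 t i t0.
apply: lerXn2r; rewrite ?nnegrE//; last nra.
by rewrite !mulr_ge0//; lra.
Qed.

Lemma le_weak_var t u : 0 <= t <= u -> weak_var t <= weak_var u.
Proof.
move=> /andP[t0 tu]; apply: ler_sum => i _.
have u0 := le_trans t0 tu.
have /andP[gt0 _] := g01 t i t0; have /andP[gu0 _] := g01 u i u0.
by apply: lerXn2r; rewrite ?nnegrE// le_landweber// t0.
Qed.

Lemma le_strong_var t u : 0 <= t <= u -> strong_var t <= strong_var u.
Proof.
move=> /andP[t0 tu]; apply: ler_sum => i _.
have u0 := le_trans t0 tu.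
have /andP[gt0 _] := g01 t i t0; have /andP[gu0 _] := g01 u i u0.
apply: ler_wpM2r; first by rewrite invr_ge0 sqr_ge0.
by apply: lerXn2r; rewrite ?nnegrE// le_landweber// t0.
Qed.

(** Each multiplication of the time by [M] makes up for one division of the index by [L], so the
    number of coordinates above the level grows at least by the factor [L], until all are
    reached. *)
Lemma level_growth (A t : R) (n k : nat) : 0 <= t ->
  (forall i, (i < n)%N -> A <= t * la i) ->
  forall i, (i < L ^ k * n)%N -> A <= M ^+ k * t * la i.
Proof.
move=> t0 H; elim: k => [|k IH] i.
  by rewrite expn0 expr0 !mul1n !mul1r; exact: H.
move=> iL; have jD : (i %/ L < D)%N by exact: leq_ltn_trans (leq_div _ _) (ltn_ord i).
have jL : (Ordinal jD < L ^ k * n)%N.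
  by rewrite /= ltn_divLR// mulnC mulnA -expnS.
apply: le_trans (IH _ jL) _; rewrite exprS.
have -> : M * M ^+ k * t * la i = M ^+ k * t * (M * la i) by ring.
by apply: ler_wpM2l; [rewrite mulr_ge0// exprn_ge0// ltW|exact: la_lo].
Qed.

Lemma level_count (A t : R) : 0 <= t ->
  exists2 n, (n <= D)%N & forall i, (i < n)%N = (A <= t * la i).
Proof.
move=> t0; pose Q k := [forall i : 'I_D, (k <= i)%N ==> (t * la i < A)].
have exQ : exists k, Q k.
  by exists D; apply/forallP => i; rewrite leqNgt ltn_ord.
case: (ex_minnP exQ) => n /forallP Qn nmin; exists n.
  by apply: nmin; apply/forallP => i; rewrite leqNgt ltn_ord.
move=> i; have [ni|ni] := leqP n i.
  by have := Qn i; rewrite ni/= => tA; apply/esym; rewrite leNgt tA.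
apply/esym; rewrite leNgt; apply/negP => tA.
suff /nmin : Q i by rewrite leqNgt ni.
apply/forallP => j; apply/implyP => ij; apply: le_lt_trans tA.
by rewrite ler_wpM2l// la_dec.
Qed.

Lemma sum_ord_lt (n : nat) : (n <= D)%N ->
  \sum_(i < D | (i < n)%N) 1 = n%:R :> R.
Proof.
by move=> nD; rewrite -(big_ord_widen D (fun=> 1))// sumr_const card_ord.
Qed.

Lemma sum_ord_itv (n m : nat) : (n <= m <= D)%N ->
  \sum_(i < D | (i < m)%N && (n <= i)%N) 1 = (m - n)%:R :> R.
Proof.
move=> /andP[nm mD]; have nD := leq_trans nm mD.
have := sum_ord_lt m mD; rewrite (bigID (fun i : 'I_D => (i < n)%N))/=.
rewrite (eq_bigl (fun i : 'I_D => (i < n)%N)); last first.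
  by move=> i; rewrite andb_idl// => /leq_trans; exact.
rewrite sum_ord_lt// natrB// => <-.
rewrite [RHS]addrC addKr; apply: eq_bigl => i; by rewrite -leqNgt.
Qed.

(** A coordinate not saturated at time [K * t] has model value at most 1/K^2 at time [t], so it
    contributes at most 4h/K^2. With K^2 >= 8 kA these sum to at most half of the weak variance; the
    saturated coordinates must supply the other half. *)
Lemma weak_var_level (K t : R) : 0 <= t -> 1 <= weak_var t -> 0 < K ->
  8 * kA <= K ^+ 2 ->
  exists2 n, (n <= D)%N & [/\ forall i, (i < n)%N -> 1 <= K * t * la i &
    weak_var t / 2 <= n%:R].
Proof.
move=> t0 v1 K0 K8; have Kt0 : 0 <= K * t by rewrite mulr_ge0// ltW.
have [n nD nE] := level_count 1 (K * t) Kt0.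
exists n => //; split; first by move=> i; rewrite nE.
have S := sum_min_le_weak_var t t0 v1.
have K20 : 0 < K ^+ 2 by rewrite exprn_gt0.
have : weak_var t <= \sum_(i < D | (i < n)%N) 1 + \sum_i 4 / K ^+ 2 * h t i.
  rewrite [X in _ <= X + _]big_mkcond/= -big_split/=; apply: ler_sum => i _.
  have /andP[h0 h1] := h01 t i; have /andP[_ gh] := g_h t i t0.
  have /andP[g0 g1] := g01 t i t0.
  have p0 : 0 <= 4 / K ^+ 2 * h t i by rewrite mulr_ge0// divr_ge0// ltW.
  case: ifPn => ni.
    by have : g t (la i) ^+ 2 <= 1; [rewrite expr_le1|lra].
  rewrite nE -ltNge in ni; rewrite add0r.
  have hK : h t i <= (K ^+ 2)^-1.
    rewrite ge_min; apply/orP; left; rewrite -[leRHS]mul1r ler_pdivlMr//.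
    rewrite -exprMn expr_le1//; last by rewrite !mulr_ge0// ltW.
    by apply: ltW; rewrite mulrC mulrA.
  by apply: (@le_trans _ _ ((2 * h t i) ^+ 2)); [apply: lerXn2r; rewrite ?nnegrE//; lra|nra].
rewrite sum_ord_lt// -mulr_sumr.
have : 4 / K ^+ 2 * \sum_i h t i <= weak_var t / 2; last lra.
apply: (@le_trans _ _ (4 / K ^+ 2 * (kA * weak_var t))).
  by apply: ler_wpM2l => //; rewrite divr_ge0// ltW.
rewrite mulrA; have -> : weak_var t / 2 = 2^-1 * weak_var t by rewrite mulrC.
apply: ler_wpM2r; first lra.
by rewrite mulrAC ler_pdivrMr//; lra.
Qed.

Lemma weak_var_ge_level t (n : nat) : 0 <= t -> (n <= D)%N ->
  (forall i, (i < n)%N -> 1 <= t * la i) -> n%:R / 4 <= weak_var t.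
Proof.
move=> t0 nD tn; rewrite -(sum_ord_lt n nD) mulr_suml big_mkcond/=.
apply: ler_sum => i _; case: ifP => [/tn ti|_]; last exact: sqr_ge0.
have hi : h t i = 1 by rewrite /h min_r// expr_ge1//; lra.
have /andP[gh _] := g_h t i t0; move: gh; rewrite hi => gh.
nra.
Qed.

(** A tail of small singular values carries a fixed share of the weak variance, and there the
    division by [la i ^+ 2] gains a factor of order W. The lower spectral condition is what prevents
    this tail from being too light. *)
Lemma weak_var_le_strong t W : 0 <= t -> 0 <= W -> W <= 4 * t ^+ 2 ->
  (forall i, i.+1 = D -> W * la i ^+ 2 <= 1) ->
  W * weak_var t <= 20 * M ^+ 2 * strong_var t.
Proof.
move=> t0 W0 Wt Wla.
have [n nD nE] := level_count M t t0.
have M2 : 0 < M ^+ 2 by rewrite exprn_gt0.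
have t1 i : (i < L * n)%N -> 1 <= t * la i.
  move=> iL; have tM j : (j < n)%N -> M <= t * la j by rewrite nE.
  have := level_growth M t n 1 t0 tM i; rewrite expn1 expr1 -mulrA => /(_ iL).
  by rewrite -{1}[M]mulr1 ler_pM2l.
have g12 i : (i < L * n)%N -> 2^-1 <= g t (la i).
  move=> /t1 ti; have hi : h t i = 1 by rewrite /h min_r// expr_ge1//; lra.
  by have /andP[gh _] := g_h t i t0; move: gh; rewrite hi; lra.
have s0 i : 0 <= g t (la i) ^+ 2 / la i ^+ 2 by rewrite divr_ge0// sqr_ge0.
(* If [D] is at most L n, all filter values are at least 1/2. The indices from [D.-1 %/ L] on, at
   least half of all, have singular values within a factor [M] of the smallest, so W la_i^2 <= M^2
   there. *)
have [DL|LD] := leqP D (L * n).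
  have vD : weak_var t <= D%:R.
    rewrite -[D in leRHS]card_ord -sumr_const; apply: ler_sum => i _.
    by have /andP[g0 g1] := g01 t i t0; rewrite expr_le1.
  case: (posnP D) => [D0|D0].
    have : D%:R = 0 :> R by rewrite D0.
    have : 0 <= strong_var t by apply: sumr_ge0.
    have : 0 <= weak_var t by apply: sumr_ge0 => i _; exact: sqr_ge0.
    move=> v0 S0 D00; have -> : weak_var t = 0 by lra.
    rewrite mulr0; apply: mulr_ge0 => //; apply: mulr_ge0 => //; exact: ltW.
  have lastD : (D.-1 < D)%N by rewrite prednK.
  pose z := Ordinal lastD.
  have jD : (D.-1 %/ L < D)%N by exact: leq_ltn_trans (leq_div _ _) lastD.
  have jlo := la_lo z (Ordinal jD) erefl.
  have Wz : W * la z ^+ 2 <= 1 by apply: Wla; rewrite /= prednK.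
  have : \sum_(i < D | (i < D)%N && (D.-1 %/ L <= i)%N) W / (4 * M ^+ 2) <=
      strong_var t.
    rewrite big_mkcond/=; apply: ler_sum => i _; rewrite ltn_ord/=.
    case: ifP => // ji; have := g12 i (leq_trans (ltn_ord i) DL) => gi.
    rewrite ler_pdivlMr ?exprn_gt0//.
    have laiz : la i <= M * la z by apply: le_trans jlo; exact: la_dec.
    have : la i ^+ 2 <= M ^+ 2 * la z ^+ 2.
      by rewrite -exprMn; apply: lerXn2r; rewrite ?nnegrE// mulr_ge0// ltW.
    move=> lai2; have : W * la i ^+ 2 <= M ^+ 2.
      apply: (@le_trans _ _ (W * (M ^+ 2 * la z ^+ 2))); first exact: ler_wpM2l.
      by rewrite mulrCA ler_piMr// ltW.
    have g2 : 4^-1 <= g t (la i) ^+ 2 by nra.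
    move=> WM; rewrite mulrAC ler_pdivrMr ?mulr_gt0//.
    by have := ler_wpM2r (ltW M2) g2; lra.
  have -> : \sum_(i < D | (i < D)%N && (D.-1 %/ L <= i)%N) W / (4 * M ^+ 2) =
      (D - D.-1 %/ L)%:R * (W / (4 * M ^+ 2)).
    rewrite -(sum_ord_itv _ D) ?leqnn ?andbT ?(ltnW jD)// mulr_suml.
    by under [RHS]eq_bigr do rewrite mul1r.
  have D2 : D%:R / 2 <= (D - D.-1 %/ L)%:R :> R.
    rewrite ler_pdivrMr// -natrM ler_nat.
    have e2 : (D.-1 %/ L * 2 <= D)%N.
      apply: leq_trans (leq_pred D); apply: leq_trans (leq_trunc_div D.-1 L).
      by rewrite leq_mul2l L2 orbT.
    by rewrite mulnBl leq_subRL ?muln2 -?addnn ?leq_add2r ?addnn -?muln2//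
      (leq_trans e2)// leq_pmulr.
  have W4 : 0 <= W / (4 * M ^+ 2) by rewrite divr_ge0// mulr_ge0// ltW.
  move=> H; have : D%:R / 2 * (W / (4 * M ^+ 2)) <= strong_var t.
    by apply: le_trans H; exact: ler_wpM2r.
  rewrite mulrA ler_pdivrMr ?mulr_gt0// => H2.
  have S0 : 0 <= strong_var t by apply: sumr_ge0.
  by have := ler_wpM2l W0 vD; nra.
(* Otherwise the tail starts at [n]. The indices between n and L n number at least n and have filter
   values at least 1/2, so Z >= n/4 and the head, at most n, is absorbed; on the tail t la_i < M. *)
pose Z := \sum_(i < D | (n <= i)%N) g t (la i) ^+ 2.
have nZ : n%:R / 4 <= Z.
  have nn : (n <= L * n)%N by rewrite leq_pmull.
  have : \sum_(i < D | (i < L * n)%N && (n <= i)%N) 4^-1 <= Z.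
    rewrite /Z big_mkcond [leRHS]big_mkcond/=; apply: ler_sum => i _.
    case: (leqP n i) => ni; rewrite ?andbF ?andbT//.
    by case: ifP => [/g12 gi|_]; [nra|exact: sqr_ge0].
  apply: le_trans.
  under eq_bigr do rewrite -[4^-1]mul1r.
  rewrite -mulr_suml sum_ord_itv ?nn ?(ltnW LD)//.
  apply: ler_wpM2r => //; rewrite ler_nat leq_subRL//.
  by rewrite addnn -mul2n leq_mul2r L2 orbT.
have vZ : weak_var t <= 5 * Z.
  have : weak_var t <= \sum_(i < D | (i < n)%N) 1 + Z.
    rewrite /weak_var (bigID (fun i : 'I_D => (i < n)%N))/=; apply: lerD.
      by apply: ler_sum => i _; have /andP[g0 g1] := g01 t i t0; rewrite expr_le1.
    by rewrite /Z le_eqVlt; apply/orP; left; apply/eqP/eq_bigl => i; rewrite -leqNgt.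
  by rewrite sum_ord_lt//; lra.
have : t ^+ 2 * Z <= M ^+ 2 * strong_var t.
  rewrite /Z /strong_var big_mkcond/= !mulr_sumr; apply: ler_sum => i _.
  case: (leqP n i) => ni; last by rewrite mulr0 mulr_ge0// ltW.
  have : t * la i < M by rewrite ltNge -nE -leqNgt.
  move=> /ltW tM; rewrite mulrA ler_pdivlMr ?exprn_gt0// -mulrA mulrCA -exprMn.
  rewrite mulrC; apply: ler_wpM2r; first exact: sqr_ge0.
  by rewrite ler_pXn2r ?nnegrE// ?mulr_ge0// ltW.
have Z0 : 0 <= Z by apply: sumr_ge0 => i _; exact: sqr_ge0.
have := ler_wpM2l W0 vZ; have := ler_wpM2r Z0 Wt; lra.
Qed.

End spectrum.

(** * Biases, and the levels that define the times *)

Lemma continuous_fsum (R : realType) (I : Type) (s : seq I)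
    (F : I -> R -> R) :
  (forall i, continuous (F i)) -> continuous (fun t => \sum_(i <- s) F i t).
Proof.
move=> cF; elim: s => [|i s IH].
  by under eq_fun do rewrite big_nil; move=> t; exact: cvg_cst.
under eq_fun do rewrite big_cons.
by move=> t; exact: cvgD (cF i t) (IH t).
Qed.

Section stopping_levels.
Context {R : realType} {D : nat} (la : 'I_D -> R).
Hypothesis la01 : forall i, 0 < la i <= 1.
Local Notation g := (@landweber R).

(** The coefficients [c] make this the strong bias, the weak bias, or the residual of a fixed
    realization, so one monotonicity, continuity and decay argument serves all three. *)
Definition bias (c : 'I_D -> R) (t : R) : R :=
  \sum_i (1 - g t (la i)) ^+ 2 * c i.

Lemma continuous_weak_var : continuous (weak_var la).
Proof.
apply: continuous_fsum => i.
have -> : (fun t => g t (la i) ^+ 2) = g^~ (la i) \* g^~ (la i).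
  by apply/funext => t; rewrite expr2.
have cg := continuous_landweber _ (la01 i).
by move=> t; exact: cvgM (cg t) (cg t).
Qed.

Lemma continuous_bias c : continuous (bias c).
Proof.
apply: continuous_fsum => i.
have cg := continuous_landweber _ (la01 i).
have cg1 : continuous (fun t => 1 - g t (la i)).
  by move=> t; exact: cvgB (@cvg_cst _ _ _ _ _) (cg t).
have -> : (fun t => (1 - g t (la i)) ^+ 2 * c i) =
   (fun t => 1 - g t (la i)) \* (fun t => 1 - g t (la i)) \* cst (c i).
  by apply/funext => t; rewrite expr2.
by move=> t; exact: cvgM (cvgM (cg1 t) (cg1 t)) (@cvg_cst _ _ _ _ _).
Qed.

Lemma bias_ge0 c t : (forall i, 0 <= c i) -> 0 <= bias c t.
Proof. by move=> c0; apply: sumr_ge0 => i _; rewrite mulr_ge0// sqr_ge0. Qed.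

Lemma le_bias c t u : (forall i, 0 <= c i) -> 0 <= t <= u ->
  bias c u <= bias c t.
Proof.
move=> c0 /andP[t0 tu]; apply: ler_sum => i _; apply: ler_wpM2r => //.
have := le_landweber t u _ (la01 i); rewrite t0 tu => /(_ erefl) gtu.
have gu := landweber_le1 u _ (la01 i) (le_trans t0 tu).
by apply: lerXn2r; rewrite ?nnegrE; lra.
Qed.

Lemma bias_le c t : (forall i, 0 <= c i) -> 0 < t ->
  bias c t <= 4 / t ^+ 2 * \sum_i c i / la i ^+ 2.
Proof.
move=> c0 t0; rewrite mulr_sumr; apply: ler_sum => i _.
have /andP[li0 li1] := la01 i.
have := landweber_decay 0 t _ (la01 i) (lexx 0) t0.
rewrite mulr0 => /(_ (ltW t0)); rewrite landweber0 subr0 expr1n mulr1 => H.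
rewrite mulrA ler_pdivlMr ?exprn_gt0// mulrAC.
by apply: ler_wpM2r => //; rewrite mulrC.
Qed.

Lemma bias_vanish c (e : R) : (forall i, 0 <= c i) -> 0 < e ->
  exists2 T, 0 < T & forall t, T <= t -> bias c t <= e.
Proof.
move=> c0 e0; pose S := \sum_i c i / la i ^+ 2.
have S0 : 0 <= S by apply: sumr_ge0 => i _; rewrite divr_ge0// sqr_ge0.
exists (1 + 4 * S / e); first by rewrite ltr_wpDr// divr_ge0// ?mulr_ge0// ltW.
move=> t Tt; have Se : 0 <= 4 * S / e by rewrite divr_ge0// ?mulr_ge0// ltW.
have t1 : 1 <= t by lra.
apply: le_trans (bias_le _ t c0 _) _; first lra.
rewrite -/S mulrAC ler_pdivrMr ?exprn_gt0//; last lra.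
have : 4 * S <= e * t by rewrite -ler_pdivrMl// mulrC; lra.
have : e * t <= e * t ^+ 2 by apply: ler_wpM2l; [exact: ltW|nra].
lra.
Qed.

Lemma weak_var_sup (c : R) : c < D%:R ->
  exists2 T, 0 < T & forall t, T <= t -> c <= weak_var la t.
Proof.
move=> cD; pose d := D%:R - c.
have d0 : 0 < d by rewrite subr_gt0.
(* A sum of squares below [e] gives 1 - g_i <= d / (2 (D + 1)) for every i, hence g_i^2 >= 1 - d /
   (D + 1), and the total deficit from D is at most d. *)
pose e := (d / (2 * D.+1%:R)) ^+ 2.
have D1 : 0 < 2 * D.+1%:R :> R by rewrite mulr_gt0// ltr0n.
have e0 : 0 < e by rewrite exprn_gt0// divr_gt0.
have [T T0 HT] := bias_vanish (fun=> 1) e (fun=> ler01) e0.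
exists T => // t Tt; have t0 : 0 <= t by apply: le_trans Tt; exact: ltW.
have gi i : 1 - g t (la i) <= d / (2 * D.+1%:R).
  have g1 := landweber_le1 t _ (la01 i) t0.
  rewrite -(@ler_pXn2r _ 2)// ?nnegrE ?subr_ge0//; last by rewrite divr_ge0// ltW.
  apply: le_trans (HT _ Tt); rewrite /bias (bigD1 i)//= mulr1 lerDl.
  by apply: sumr_ge0 => j _; rewrite mulr1 sqr_ge0.
have : \sum_(i < D) (1 - 2 * (d / (2 * D.+1%:R))) <= weak_var la t.
  apply: ler_sum => i _; have := gi i; move: (d / _) => y giy.
  by have := sqr_ge0 (1 - g t (la i)); lra.
apply: le_trans; rewrite sumr_const card_ord -[_ *+ D]mulr_natr.
have -> : 2 * (d / (2 * D.+1%:R)) = d / D.+1%:R.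
  by field; rewrite nat1r pnatr_eq0.
rewrite mulrBl mul1r.
have : d / D.+1%:R * D%:R <= d.
  rewrite mulrAC ler_pdivrMr ?ltr0n//.
  by apply: ler_wpM2l; [exact: ltW|rewrite ler_nat].
by move: (d / D.+1%:R * D%:R) => y; rewrite /d; lra.
Qed.

Lemma level_inf (c : R) : 0 <= c < D%:R ->
  let T := inf [set t : R | 0 <= t /\ weak_var la t = c] in
  0 <= T /\ weak_var la T = c.
Proof.
move=> /andP[c0 cD]; set S := [set t : R | _] => T.
have [u u0 uc] := weak_var_sup c cD.
have v0 : weak_var la 0 = 0.
  by apply: big1 => i _; rewrite landweber0 expr0n.
have level a b z : 0 <= a <= b -> weak_var la a <= z <= weak_var la b ->
    exists2 r, a <= r <= b & weak_var la r = z.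
  move=> /andP[a0 ab] /andP[az zb].
  have := @IVT _ (weak_var la) a b z ab _ _.
  have -> : Num.min (weak_var la a) (weak_var la b) = weak_var la a.
    by apply: min_l; exact: le_trans zb.
  have -> : Num.max (weak_var la a) (weak_var la b) = weak_var la b.
    by apply: max_r; exact: le_trans zb.
  case=> [||r]; last by rewrite in_itv/= => rab <-; exists r.
    by apply: continuous_subspaceT; exact: continuous_weak_var.
  by rewrite az zb.
have Sne : S !=set0.
  have [||r] := level 0 u c; first by rewrite lexx ltW.
    by rewrite v0 c0 uc.
  by move=> /andP[r0 _] rc; exists r.
have Slb : lbound S 0 by move=> t [].
have T0 : 0 <= T by exact: lb_le_inf.
split => //; case: Sne => s Ss.
have Ts : T <= s by apply: ge_inf => //; exists 0.
have [s0 sc] := Ss.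
have Tc : weak_var la T <= c by rewrite -sc le_weak_var// T0.
apply/eqP; rewrite eq_le Tc/= leNgt; apply/negP => Tc'.
(* If the level were not reached at the infimum, a time [r] beyond it would still have weak variance
   strictly below [c]; some element of the set lies before [r], against monotonicity. *)
have [||r] := level T s ((weak_var la T + c) / 2); first by rewrite T0.
  by rewrite sc; apply/andP; split; lra.
move=> /andP[Tr rs] rE.
have Tr' : T < r.
  by rewrite lt_neqAle Tr andbT; apply/eqP => TrE; move: rE; rewrite -TrE; lra.
have [|s' [s'0 s'c] s'r] := @inf_lt _ S r _ Tr'; first by exists s.
have : weak_var la s' <= weak_var la r by rewrite le_weak_var// s'0 ltW.
by rewrite s'c rE; lra.
Qed.

End stopping_levels.

(** * Deviations of the stopping time *)

Section deviations.
Context {R : realType} {D : nat} (L : nat) (M q : R) (la : 'I_D -> R).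
Hypotheses (L2 : (2 <= L)%N) (M0 : 0 < M) (q0 : 0 <= q)
  (q1 : q ^+ 2 * L%:R < 1) (la01 : forall i, 0 < la i <= 1)
  (la_dec : forall i j : 'I_D, (i <= j)%N -> la j <= la i)
  (la_lo : forall i j : 'I_D, j = (i %/ L)%N :> nat -> la j <= M * la i)
  (la_hi : forall i j : 'I_D, j.+1 = (i.+1 %/ L)%N -> la i <= q * la j).
Context {d : measure_display} {T : measurableType d} (P : probability T R)
  (eps : 'I_D -> {RV P >-> R}).
Hypotheses (indep : mutually_independent eps)
  (nor : forall i, standard_normal (eps i)).
Context (m : 'I_D -> R) (kap Ck Co T0 : R).
Hypotheses (D0 : (0 < D)%N) (Co1 : 1 <= Co) (CkCo : 0 <= Ck < Co)
  (hkap : `|kap - D%:R| <= Ck * Num.sqrt D%:R)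
  (T00 : 0 <= T0) (vT0 : weak_var la T0 = Co * Num.sqrt D%:R).

Local Notation g := (@landweber R).
Local Notation rD := (Num.sqrt (D%:R : R)).
Let s : R := (8 * rD)^-1.
(** The gap between [Ck] and [Co] yields a margin 4 c v between the mean noise residual and the
    threshold. A weak bias of at most c v uses 3/2 c v of it in the Chernoff bound, so 2 c v
    survives in the exponent. *)
Let c : R := (1 - Ck / Co) / 4.
Local Notation v := (weak_var la).
Local Notation weak_bias := (bias la (fun i => la i ^+ 2 * m i ^+ 2)).
Local Notation rr t w := (bias la (fun i => (la i * m i + eps i w) ^+ 2) t).

Let rD2 : rD ^+ 2 = D%:R. Proof. by rewrite sqr_sqrtr. Qed.
Let rD1 : 1 <= rD.
Proof. by rewrite -[leLHS]sqrtr1 ler_wsqrtr// ler1n. Qed.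
Let s0 : 0 < s. Proof. by rewrite invr_gt0; have := rD1; lra. Qed.
Let srD : s * rD = 8^-1.
Proof. by rewrite /s; field; move: rD1; lra. Qed.
Let s8 : s <= 8^-1.
Proof. by rewrite -srD ler_peMr// ltW. Qed.
Let s2D : 4 * s ^+ 2 * D%:R = 16^-1.
Proof.
have -> : 4 * s ^+ 2 * D%:R = 4 * (s * rD) ^+ 2.
  by rewrite [(s * rD) ^+ 2]exprMn rD2; ring.
by rewrite srD; field.
Qed.
Let c0 : 0 < c.
Proof.
have /andP[Ck0 ckco] := CkCo.
by rewrite divr_gt0// subr_gt0 ltr_pdivrMr ?mul1r//; lra.
Qed.
Let Ck_le t : T0 <= t -> Ck * rD <= (1 - 4 * c) * v t.
Proof.
move=> Tt; have vt : v T0 <= v t by rewrite le_weak_var// T00.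
have Co0 : 0 < Co by exact: lt_le_trans Co1.
have -> : 1 - 4 * c = Ck / Co by rewrite /c; field; lra.
have /andP[Ck0 _] := CkCo.
have -> : Ck * rD = Ck / Co * v T0 by rewrite vT0; field; lra.
by apply: ler_wpM2l => //; rewrite divr_ge0// ltW.
Qed.
Let rD_le t : T0 <= t -> rD <= v t.
Proof.
move=> Tt; have vt : v T0 <= v t by rewrite le_weak_var// T00.
by apply: le_trans vt; rewrite vT0 ler_peMl//; have := rD1; lra.
Qed.
Let v_ge1 t : T0 <= t -> 1 <= v t.
Proof. by move=> /rD_le; have := rD1; lra. Qed.

Let a t i : R := (1 - g t (la i)) ^+ 2.
Let a01 t i : 0 <= t -> 0 <= a t i <= 1.
Proof.
move=> t0; have g0 := landweber_ge0 t _ (la01 i) t0.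
have g1 := landweber_le1 t _ (la01 i) t0.
by rewrite sqr_ge0 expr_le1//; lra.
Qed.

(** For g in [0, 1], (1 - g)^2 <= 1 - g^2: the mean noise left in the residual is below [D] by at
    least the weak variance, which exceeds the uncertainty of the threshold. *)
Let sum_a_le t : 0 <= t -> \sum_i a t i <= D%:R - v t.
Proof.
move=> t0; have -> : D%:R - v t = \sum_(i < D) (1 - g t (la i) ^+ 2).
  by rewrite sumrB sumr_const card_ord.
apply: ler_sum => i _; have g0 := landweber_ge0 t _ (la01 i) t0.
have g1 := landweber_le1 t _ (la01 i) t0; rewrite /a; nra.
Qed.

Let sum_a_ge t : T0 <= t -> D%:R - 4 * kA L q * v t <= \sum_i a t i.
Proof.
move=> Tt; have t0 := le_trans T00 Tt.
have S := sum_landweber_le L q la L2 q0 q1 la01 la_hi t t0 (v_ge1 t Tt).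
apply: (@le_trans _ _ (D%:R - 2 * \sum_i g t (la i))).
  by rewrite lerD2l lerN2; move: S; lra.
have -> : D%:R - 2 * \sum_i g t (la i) = \sum_(i < D) (1 - 2 * g t (la i)).
  by rewrite sumrB sumr_const card_ord mulr_sumr.
by apply: ler_sum => i _; rewrite /a; have := sqr_ge0 (g t (la i)); lra.
Qed.

Let weak_biasE t :
  \sum_i a t i * (la i * m i) ^+ 2 = weak_bias t.
Proof. by apply: eq_bigr => i _; rewrite exprMn. Qed.

Let weak_bias0 t : 0 <= weak_bias t.
Proof. by apply: bias_ge0 => i; rewrite mulr_ge0 ?sqr_ge0. Qed.

(** The second-order term in [D] equals 1/16 by the choice of [s], so 2 covers it together with the
    1 due to the extra coordinate; the second-order term in the weak bias is at most half of the
    first-order one, as s <= 1/8. *)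
Let mgf t (z : R) j : 0 <= t -> `|z| = s ->
  mean_le R d T P (fun w => expR (z * (rr t w - kap) + eps j w ^+ 2 / 8))
    (expR (z * (\sum_i a t i + weak_bias t - kap) + s * weak_bias t / 2 + 2)).
Proof.
move=> t0 zs; have a01' i := a01 t i t0.
have zs8 : `|z| <= 8^-1 by rewrite zs.
have H := mean_le_expR_noncentral_chi2 R d T P D eps (a t)
  (fun i => la i * m i) z j indep nor a01' zs8.
have := mean_leZ P (expR (- (z * kap))) _ _ (expR_ge0 _) H.
under eq_fun do rewrite -expRD.
have -> : (fun w => expR (- (z * kap) + (z * (\sum_i a t i *
     (la i * m i + eps i w) ^+ 2) + eps j w ^+ 2 / 8))) =
     (fun w => expR (z * (rr t w - kap) + eps j w ^+ 2 / 8)).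
  by apply/funext => w; congr expR; rewrite /bias; ring.
apply: mean_leW; rewrite -expRD ler_expR weak_biasE.
have z2 : z ^+ 2 = s ^+ 2 by rewrite -zs real_normK// num_real.
rewrite z2 s2D.
have : 4 * s ^+ 2 * weak_bias t <= s * weak_bias t / 2.
  have -> : s * weak_bias t / 2 = s * 2^-1 * weak_bias t by ring.
  by apply: ler_wpM2r => //; have := s8; have := s0; nra.
lra.
Qed.

Lemma residual_above j t : T0 <= t -> weak_bias t <= c * v t ->
  mean_le R d T P (fun w => expR (s * (rr t w - kap) + eps j w ^+ 2 / 8))
    (expR (2 - 2 * c * (s * v t))).
Proof.
move=> Tt bv; have t0 := le_trans T00 Tt.
apply: mean_leW (mgf t s j t0 (gtr0_norm s0)).
rewrite ler_expR; have := sum_a_le t t0; have := Ck_le t Tt.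
move: hkap; rewrite ler_norml => /andP[k1 k2].
move=> h1 h2; have key : \sum_i a t i + weak_bias t - kap + weak_bias t / 2 <=
    - (2 * c * v t).
  have := mulr_ge0 (ltW c0) (le_trans ler01 (v_ge1 t Tt)); lra.
have := ler_wpM2l (ltW s0) key; lra.
Qed.

Lemma residual_below j t : T0 <= t ->
  mean_le R d T P (fun w => expR (- s * (rr t w - kap) + eps j w ^+ 2 / 8))
    (expR (2 - s * (weak_bias t / 2 - (4 * kA L q + 1) * v t))).
Proof.
move=> Tt; have t0 := le_trans T00 Tt.
have ns : `|- s| = s by rewrite normrN gtr0_norm.
apply: mean_leW (mgf t (- s) j t0 ns).
rewrite ler_expR; have := sum_a_ge t Tt; have := Ck_le t Tt.
move: hkap; rewrite ler_norml => /andP[k1 k2].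
move=> h1 h2; have key : kap - \sum_i a t i <= (4 * kA L q + 1) * v t.
  have := mulr_ge0 (ltW c0) (le_trans ler01 (v_ge1 t Tt)); lra.
have := ler_wpM2l (ltW s0) key; lra.
Qed.

Context (p : nat).
(** The exponential tail will be used only through its polynomial bound of order p + 1. This order
    beats the growth M^4 of the strong variance per grid step with a factor 2 to spare, which makes
    the series geometric. *)
Hypothesis hp : 2 * M ^+ 4 <= L%:R ^+ p.+1.

Let M1 : 1 <= M.
Proof.
have lo := la_lo (Ordinal D0) (Ordinal D0) (esym (div0n L)).
have /andP[l0 _] := la01 (Ordinal D0).
by rewrite -(ler_pM2r l0) mul1r.
Qed.

(** The first term is the noise up to the start of the grid; the second is the sum over the grid
    cells, including the total 2 of the geometric series. *)
Definition kU : R := 128 * expR 1 +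
  4096 * expR 2 * M ^+ 4 * p.+1`!%:R * (32 / c) ^+ p.+1.

Let hh (t : R) (i : 'I_D) : R := Num.min ((t * la i) ^+ 2) 1.

Let hh0 t i : 0 <= hh t i.
Proof. by rewrite le_min sqr_ge0 ler01. Qed.

Let le_hh t u i : 0 <= t <= u -> hh t i <= hh u i.
Proof.
move=> /andP[t0 tu]; have /andP[l0 _] := la01 i.
rewrite le_min ge_min ge_min lexx orbT andbT; apply/orP; left.
have u0 := le_trans t0 tu.
apply: lerXn2r; rewrite ?nnegrE ?mulr_ge0 ?(ltW l0)//.
by rewrite ler_wpM2r// ltW.
Qed.

(** 32 = 4 * 8, from g^2 <= 4 hh^2 and eps^2 <= 8 exp (eps^2 / 8). *)
Let B t i : R := 32 * hh t i ^+ 2 / la i ^+ 2.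

Let B0 t i : 0 <= B t i.
Proof. by rewrite divr_ge0 ?sqr_ge0// mulr_ge0// sqr_ge0. Qed.

Let sumB_le t : 0 <= t -> \sum_i B t i <= 128 * strong_var la t.
Proof.
move=> t0; rewrite mulr_sumr; apply: ler_sum => i _.
rewrite /B [leRHS]mulrA; apply: ler_wpM2r; first by rewrite invr_ge0 sqr_ge0.
have := landweber_lower t _ (la01 i) t0; have := hh0 t i; rewrite -/(hh t i).
by move: (g t (la i)) (hh t i) => y z z0 zy; nra.
Qed.

Let noise_le t w : 0 <= t ->
  \sum_i g t (la i) ^+ 2 / la i ^+ 2 * eps i w ^+ 2 <=
  \sum_i B t i * expR (eps i w ^+ 2 / 8).
Proof.
move=> t0; apply: ler_sum => i _.
have g2 : g t (la i) ^+ 2 <= 4 * hh t i ^+ 2.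
  have := landweber_upper t _ (la01 i) t0; rewrite -/(hh t i).
  have := landweber_ge0 t _ (la01 i) t0; have := hh0 t i.
  by move: (g t (la i)) (hh t i) => y z; nra.
have e2 : eps i w ^+ 2 <= 8 * expR (eps i w ^+ 2 / 8).
  by have := expR_ge1Dx (eps i w ^+ 2 / 8); lra.
have -> : B t i * expR (eps i w ^+ 2 / 8) =
  4 * hh t i ^+ 2 / la i ^+ 2 * (8 * expR (eps i w ^+ 2 / 8)).
  by rewrite /B; ring.
apply: ler_pM => //; rewrite ?sqr_ge0 ?divr_ge0 ?sqr_ge0//.
by apply: ler_wpM2r => //; rewrite invr_ge0 sqr_ge0.
Qed.

Let chi2_exp j : mean_le R d T P (fun w => expR (eps j w ^+ 2 / 8)) (expR 1).
Proof.
have z8 : `|0 : R| <= 8^-1 by rewrite normr0 invr_ge0.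
have a0 : forall i : 'I_D, 0 <= (0 : R) <= 1 by rewrite lexx ler01.
have := mean_le_expR_noncentral_chi2 R d T P D eps (fun=> 0) (fun=> 0)
  0 j indep nor a0 z8.
under eq_fun do rewrite mul0r add0r.
by rewrite expr0n /= !(mul0r, mulr0, add0r).
Qed.

Lemma expRN_le_exp (y : R) (n : nat) : 0 < y ->
  expR (- y) <= n.+1`!%:R / y ^+ n.+1.
Proof.
move=> y0; rewrite expRN -[leRHS]invrK lef_pV2 ?posrE ?expR_gt0//; last first.
  by rewrite invr_gt0 divr_gt0 ?exprn_gt0// ltr0n fact_gt0.
rewrite invfM invrK mulrC; have := expR_ge1Dxn n (ltW y0); lra.
Qed.

Let grid_cases (u : nat -> R) (K : nat) (x : R) : 
  x <= u 0%N \/ (exists2 k, (k < K)%N & u k < x <= u k.+1) \/ u K < x.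
Proof.
elim: K => [|K [H|[[k kK H]|H]]].
- by case: (leP x (u 0%N)) => H; [left|right; right].
- by left.
- by right; left; exists k => //; exact: ltnW.
- case: (leP x (u K.+1)) => H'; [right; left|by right; right].
  by exists K => //; rewrite H.
Qed.

(** If stopping occurs in the cell after [tk k], the noise is at most its value at the end of the
    cell times the exponential of the excess residual at [tk k]. The mean of this exponential falls
    like exp (- c L^k / 32) up to constants, so the sum over cells is of the order of the first
    term. *)
Lemma noise_after_crossing t1 n0 : T0 <= t1 -> weak_bias t1 <= c * v t1 ->
  (n0 <= D)%N -> (forall i : 'I_D, (i < n0)%N -> 1 <= t1 * la i) ->
  rD / 2 <= n0%:R ->
  exists2 F : T -> R, mean_le R d T P F (kU * strong_var la t1) &
    forall w x, 0 <= x -> (forall t, T0 <= t < x -> kap < rr t w) ->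
    \sum_i g x (la i) ^+ 2 / la i ^+ 2 * eps i w ^+ 2 <= F w.
Proof.
move=> T0t1 bt1 n0D n0la rDn0.
have t10 : 0 <= t1 by exact: le_trans T0t1.
have n00 : (0 < n0)%N.
  rewrite lt0n; apply: contraL isT => /eqP n00; move: rDn0; rewrite n00.
  by have := rD1; lra.
pose tk k := M ^+ k * t1.
have tkS k : tk k <= tk k.+1.
  by rewrite /tk exprS -mulrA ler_peMl// mulr_ge0// exprn_ge0// ltW.
have tk0 k : 0 <= tk k by rewrite mulr_ge0// exprn_ge0// ltW.
have t1k k : t1 <= tk k by rewrite ler_peMl// exprn_ege1.
have tk_level k : forall i : 'I_D, (i < L ^ k * n0)%N -> 1 <= tk k * la i.
  exact: (level_growth L M la L2 M0 la_lo 1 t1 n0 k t10 n0la).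
(* From [tk K] on all coordinates are saturated and [hh] equals 1, so finitely many cells suffice:
   the last one also covers every later time. *)
have exK : exists K, (D <= L ^ K * n0)%N.
  exists D; apply: leq_trans (leq_pmulr _ n00); apply: ltnW; exact: ltn_expl.
case: (ex_minnP exK) => K DK Kmin.
have ltK k : (k < K)%N -> (L ^ k * n0 <= D)%N.
  by move=> kK; rewrite leqNgt; apply/negP => /ltnW /Kmin; rewrite leqNgt kK.
pose E2 k i w := expR (s * (rr (tk k) w - kap) + eps i w ^+ 2 / 8).
pose F w := \sum_i B t1 i * expR (eps i w ^+ 2 / 8) +
   \sum_(k < K) \sum_i B (tk k.+1) i * E2 k i w.
have BE1_0 w : 0 <= \sum_i B t1 i * expR (eps i w ^+ 2 / 8).
  by apply: sumr_ge0 => i _; rewrite mulr_ge0// expR_ge0.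
have BE2_0 k w : 0 <= \sum_i B (tk k.+1) i * E2 k i w.
  by apply: sumr_ge0 => i _; rewrite mulr_ge0// expR_ge0.
exists F; last first.
  move=> w x x0 xcross; apply: le_trans (noise_le x w x0) _.
  have first_case : (forall i, hh x i <= hh t1 i) ->
      \sum_i B x i * expR (eps i w ^+ 2 / 8) <= F w.
    move=> hx; apply: (@le_trans _ _ (\sum_i B t1 i * expR (eps i w ^+ 2 / 8))).
      apply: ler_sum => i _; rewrite ler_wpM2r ?expR_ge0//.
      rewrite ler_wpM2r ?invr_ge0 ?sqr_ge0// ler_wpM2l//.
      by apply: lerXn2r; rewrite ?nnegrE.
    by rewrite lerDl sumr_ge0.
  (* At [tk k], before the crossing, the residual exceeds [kap]; hence [E2] is at least exp (eps^2 /
     8) and plays the role of the indicator of this event. *)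
  have grid_case k : (k < K)%N -> tk k < x ->
      (forall i, hh x i <= hh (tk k.+1) i) ->
      \sum_i B x i * expR (eps i w ^+ 2 / 8) <= F w.
    move=> kK kx hx; apply: (@le_trans _ _ (\sum_i B (tk k.+1) i * E2 k i w)).
      apply: ler_sum => i _; apply: ler_pM; rewrite ?expR_ge0//.
        rewrite ler_wpM2r ?invr_ge0 ?sqr_ge0// ler_wpM2l//.
        by apply: lerXn2r; rewrite ?nnegrE.
      rewrite ler_expR lerDr mulr_ge0 ?(ltW s0)// subr_ge0 ltW// xcross//.
      by rewrite kx (le_trans T0t1 (t1k _)).
    rewrite /F (bigD1 (Ordinal kK))//= addrCA lerDl addr_ge0// sumr_ge0//.
  have top i : hh (tk K) i = 1.
    have := tk_level K i (leq_trans (ltn_ord i) DK) => ti.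
    by rewrite /hh min_r// exprn_ege1.
  have hh1 t i : hh t i <= 1 by rewrite ge_min lexx orbT.
  have [x1|[[k kK /andP[kx xk]]|Kx]] := grid_cases tk K x.
  - by apply: first_case => i; rewrite le_hh// x0/=; move: x1; rewrite /tk expr0 mul1r.
  - by apply: (grid_case k) => // i; rewrite le_hh// x0.
  - have [K0|K0] := posnP K.
      apply: first_case => i; have := top i; rewrite K0 /tk expr0 mul1r => ->.
      exact: hh1.
    have KE : K.-1.+1 = K by rewrite prednK.
    apply: (grid_case K.-1); first by rewrite -ltnS KE.
      by apply: le_lt_trans Kx; rewrite -[leRHS]/(tk K) -{2}KE.
    by move=> i; rewrite KE top.
have V0 : 0 <= strong_var la t1.
  by apply: sumr_ge0 => i _; rewrite divr_ge0 ?sqr_ge0.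
pose C2 := 2048 * expR 2 * M ^+ 4 * p.+1`!%:R * (32 / c) ^+ p.+1.
have C20 : 0 <= C2.
  have X1 : 0 <= (32 / c) ^+ p.+1 by rewrite exprn_ge0// divr_ge0// ltW.
  have X2 : 0 <= M ^+ 4 by rewrite exprn_ge0// ltW.
  have X3 := expR_ge0 (2 : R).
  exact: mulr_ge0 (mulr_ge0 (mulr_ge0 (mulr_ge0 (ler0n R 2048) X3) X2)
    (ler0n R _)) X1.
have S1 : mean_le R d T P (fun w => \sum_i B t1 i * expR (eps i w ^+ 2 / 8))
    (128 * expR 1 * strong_var la t1).
  apply: (mean_leW _ _ (\sum_i B t1 i * expR 1)).
    rewrite -mulr_suml mulrAC ler_wpM2r ?expR_ge0//; exact: sumB_le.
  by apply: mean_le_sum => i; apply: mean_leZ.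
have S2 : mean_le R d T P (fun w => \sum_(k < K) \sum_i B (tk k.+1) i * E2 k i w)
    (\sum_(k < K) C2 * strong_var la t1 / 2 ^+ k).
  apply: mean_le_sum => k.
  pose z := 2 * c * (s * v (tk k)).
  have T0k : T0 <= tk k by exact: le_trans (t1k k).
  have bk : weak_bias (tk k) <= c * v (tk k).
    apply: (@le_trans _ _ (weak_bias t1)).
      by apply: le_bias => //; [move=> i; rewrite mulr_ge0 ?sqr_ge0|rewrite t10 t1k].
    apply: le_trans bt1 _; rewrite ler_wpM2l ?(ltW c0)//.
    by rewrite le_weak_var// t10 t1k.
  apply: (mean_leW _ _ (\sum_i B (tk k.+1) i * expR (2 - z))); last first.
    by apply: mean_le_sum => i; apply: mean_leZ => //; exact: residual_above.
  have Lk0 : 0 < (L%:R : R) ^+ k by rewrite exprn_gt0// ltr0n; exact: leq_trans L2.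
  (* L^k n0 saturated coordinates give v >= L^k rD / 8; then s rD = 1/8 and the factor 2c give c /
     32, independently of [D]. *)
  have zk : c / 32 * L%:R ^+ k <= z.
    have vk := weak_var_ge_level la la01 (tk k) _ (tk0 k) (ltK k (ltn_ord k))
      (tk_level k).
    rewrite natrM natrX in vk.
    have : s * (L%:R ^+ k * rD / 8) <= s * v (tk k).
      rewrite ler_wpM2l ?(ltW s0)//; apply: le_trans vk.
      have := ler_wpM2l (ltW Lk0) rDn0; lra.
    have -> : s * (L%:R ^+ k * rD / 8) = (s * rD) * (L%:R ^+ k / 8) by ring.
    rewrite srD => sv; have := ler_wpM2l (ltW c0) sv; rewrite /z; lra.
  have z00 : 0 < c / 32 * L%:R ^+ k by rewrite mulr_gt0// divr_gt0.
  have ez : expR (- z) <= p.+1`!%:R * (32 / c) ^+ p.+1 / (L%:R ^+ k) ^+ p.+1.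
    apply: (@le_trans _ _ (expR (- (c / 32 * L%:R ^+ k)))).
      by rewrite ler_expR lerN2.
    apply: le_trans (expRN_le_exp _ p z00) _.
    by rewrite -[32 / c]invf_div exprVn exprMn invfM mulrA.
  rewrite -mulr_suml expRD.
  have Vk : strong_var la (tk k.+1) <= 16 * (M ^+ k.+1) ^+ 4 * strong_var la t1.
    by apply: strong_var_scale => //; exact: exprn_ege1.
  have Sk := sumB_le (tk k.+1) (tk0 _).
  apply: (@le_trans _ _ (128 * (16 * (M ^+ k.+1) ^+ 4 * strong_var la t1) *
      (expR 2 * (p.+1`!%:R * (32 / c) ^+ p.+1 / (L%:R ^+ k) ^+ p.+1)))).
    apply: ler_pM.
    - by apply: sumr_ge0.
    - by rewrite mulr_ge0 ?expR_ge0.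
    - by apply: le_trans Sk _; rewrite ler_wpM2l.
    - by rewrite ler_wpM2l ?expR_ge0.
  have ML : (M ^+ k) ^+ 4 / (L%:R ^+ k) ^+ p.+1 <= (2 ^+ k)^-1.
    have hpk : (2 * M ^+ 4) ^+ k <= (L%:R ^+ p.+1) ^+ k.
      apply: lerXn2r => //; rewrite ?nnegrE ?exprn_ge0//.
      by rewrite mulr_ge0// exprn_ge0// ltW.
    rewrite ler_pdivrMr; last exact: exprn_gt0.
    rewrite mulrC ler_pdivlMr; last exact: exprn_gt0.
    rewrite [leLHS]mulrC -[(M ^+ k) ^+ 4]exprM [(k * 4)%N]mulnC exprM -exprMn.
    by rewrite -[(L%:R ^+ k) ^+ p.+1]exprM [(k * p.+1)%N]mulnC exprM.
  have -> : 128 * (16 * (M ^+ k.+1) ^+ 4 * strong_var la t1) *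
      (expR 2 * (p.+1`!%:R * (32 / c) ^+ p.+1 / (L%:R ^+ k) ^+ p.+1)) =
      C2 * strong_var la t1 * ((M ^+ k) ^+ 4 / (L%:R ^+ k) ^+ p.+1).
    rewrite /C2 [M ^+ k.+1]exprS [(M * M ^+ k) ^+ 4]exprMn.
    move: (M ^+ 4) ((M ^+ k) ^+ 4) ((32 / c) ^+ p.+1) (p.+1`!%:R : R) => y1 y2 y3 y4.
    by move: ((L%:R ^+ k) ^+ p.+1)^-1 (strong_var la t1) (expR 2) => y5 y6 y7; ring.
  by rewrite ler_wpM2l// mulr_ge0.
apply: mean_leW (mean_leD _ _ _ _ _ S1 S2).
rewrite -mulr_sumr.
have geo (n : nat) : \sum_(k < n) (2 ^+ k)^-1 <= 2 :> R.
  have -> : \sum_(k < n) (2 ^+ k)^-1 = 2 - 2 / 2 ^+ n :> R.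
    elim: n => [|n IH]; first by rewrite big_ord0 expr0; field.
    rewrite big_ord_recr/= IH exprS; field.
    by rewrite expf_neq0.
  by rewrite lerBlDr lerDl divr_ge0// exprn_ge0.
have := ler_wpM2l (mulr_ge0 C20 V0) (geo K).
rewrite /kU -/C2; rewrite /C2; lra.
Qed.

(** Once the weak bias exceeds kC v, the term (4 kA + 1) v in the lower-tail exponent is at most a
    quarter of the weak bias, half of what is gained. In [kL], 10240 = 2048 + 2 * 4096: the level at
    [ts] and the dyadic series. *)
Definition kC : R := 4 * (4 * kA L q + 1).
Definition kL : R := kC + 10240 * expR 2.

Let kA0 : 0 < kA L q. Proof. exact: kA_gt0. Qed.

Let kC_ge1 : 1 <= kC. Proof. by rewrite /kC; have := kA0; lra. Qed.

(** The levels discretize the values of the weak bias rather than time: stopping where the weak bias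
    is in a dyadic band forces the residual below [kap] at the deterministic time at which the weak
    bias equals the lower end of the band. *)
Lemma bias_before_crossing ts : T0 <= ts ->
  exists2 F : T -> R, mean_le R d T P F (kL * v ts) &
    forall w x, T0 <= x < ts -> (forall t, x < t -> rr t w <= kap) ->
    weak_bias x <= F w.
Proof.
move=> T0ts; have ts0 : 0 <= ts by exact: le_trans T0ts.
have vts := rD_le ts T0ts; have vts1 := v_ge1 ts T0ts.
have kCv : v ts <= kC * v ts by rewrite ler_peMl//; exact: le_trans vts1.
(* Any coordinate will do: its nonnegative exponent only enlarges [E]. *)
pose j0 := Ordinal D0.
pose E t w := expR (- s * (rr t w - kap) + eps j0 w ^+ 2 / 8).
have E1 t w : rr t w <= kap -> 1 <= E t w.
  move=> rk; rewrite -expR0 ler_expR addr_ge0 ?divr_ge0 ?sqr_ge0//.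
  by rewrite mulNr -mulrN mulr_ge0 ?(ltW s0)// opprB subr_ge0.
have E0 t w : 0 <= E t w by exact: expR_ge0.
have weight_ge0 i : 0 <= la i ^+ 2 * m i ^+ 2 by rewrite mulr_ge0 ?sqr_ge0.
have Emean t : T0 <= t <= ts -> kC * v ts <= weak_bias t ->
    mean_le R d T P (fun w => weak_bias t * E t w)
      (2048 * expR 2 * D%:R / weak_bias t).
  move=> /andP[T0t tts] bt; have bt0 : 0 < weak_bias t by lra.
  have H := mean_leZ P (weak_bias t) _ _ (ltW bt0) (residual_below j0 t T0t).
  apply: mean_leW H; set y := s * weak_bias t / 4.
  have y0 : 0 < y by rewrite divr_gt0// mulr_gt0.
  have vt : v t <= v ts by rewrite le_weak_var// (le_trans T00 T0t).
  have ey : expR (2 - s * (weak_bias t / 2 - (4 * kA L q + 1) * v t)) <=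
      expR 2 * expR (- y).
    rewrite -expRD ler_expR.
    have : (4 * kA L q + 1) * v t <= weak_bias t / 4.
      have : (4 * kA L q + 1) * v t <= (4 * kA L q + 1) * v ts.
        by rewrite ler_wpM2l//; have := kA0; lra.
      by move: bt; rewrite /kC; lra.
    by move=> h; have := ler_wpM2l (ltW s0) h; rewrite /y; lra.
  (* Order two is enough: after multiplication by the weak bias, a decay of order one remains along
     the doubling levels. As s^2 = 1 / (64 D), y^2 = weak_bias^2 / (1024 D). *)
  apply: (@le_trans _ _ (weak_bias t * (expR 2 * (2%:R / y ^+ 2)))).
    rewrite ler_wpM2l ?(ltW bt0)//; apply: le_trans ey _.
    by rewrite ler_wpM2l ?expR_ge0//; exact: (expRN_le_exp y 1).
  rewrite le_eqVlt; apply/orP; left; apply/eqP.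
  have s2 : s ^+ 2 = (64 * D%:R)^-1.
    have D00 : (D%:R : R) != 0 by rewrite pnatr_eq0 -lt0n.
    by rewrite -[LHS](mulfK D00) -(mulKf (_ : 4 != 0 :> R) (s ^+ 2 * D%:R))//
      [4 * _]mulrA s2D; field.
  have -> : y ^+ 2 = s ^+ 2 * weak_bias t ^+ 2 / 16 by rewrite /y; field.
  rewrite s2; field.
  by rewrite gt_eqF//= pnatr_eq0 -lt0n.
(* Levels below the weak bias at [ts] are not attained before [ts]. Values between kC v and this
   weak bias are handled by [G1], at the time [ts] itself. *)
pose b0 := Num.max (weak_bias ts) (kC * v ts).
pose b j : R := 2 ^+ j * b0.
have b0v : kC * v ts <= b0 by rewrite le_max lexx orbT.
have b00 : 0 < b0 by lra.
have b0b j : b0 <= b j.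
  by rewrite ler_peMl ?(ltW b00)//; apply: exprn_ege1; lra.
(* For levels above the weak bias at [T0] the value 0 is a placeholder, since [G2] vanishes
   there. *)
have /choice[tj Htj] : forall j, exists t, b j <= weak_bias T0 ->
    T0 <= t <= ts /\ weak_bias t = b j.
  move=> j; have [bT|_] := leP (b j) (weak_bias T0); last by exists 0.
  have bts : weak_bias ts <= b j.
    by apply: le_trans (b0b j); rewrite le_max lexx.
  have := @IVT _ (weak_bias) T0 ts (b j) T0ts _ _.
  have -> : Num.min (weak_bias T0) (weak_bias ts) = weak_bias ts.
    by apply: min_r; exact: le_trans bT.
  have -> : Num.max (weak_bias T0) (weak_bias ts) = weak_bias T0.
    by apply: max_l; exact: le_trans bT.
  case=> [||r]; last by rewrite in_itv/= => rab rb; exists r.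
    by apply: continuous_subspaceT; exact: continuous_bias.
  by rewrite bts bT.
have [J HJ] : exists J, weak_bias T0 <= b J.
  have q0' : 0 <= weak_bias T0 / b0 by rewrite divr_ge0 ?(ltW b00).
  exists (Num.bound (weak_bias T0 / b0)).
  rewrite -ler_pdivrMr//; apply: le_trans (ltW (archi_boundP q0')) _.
  by rewrite -natrX ler_nat ltnW// ltn_expl.
pose G1 w := if kC * v ts <= weak_bias ts then weak_bias ts * E ts w else 0.
pose G2 j w := if b j <= weak_bias T0 then 2 * (weak_bias (tj j) * E (tj j) w) else 0.
have G10 w : 0 <= G1 w by rewrite /G1; case: ifP => // _; rewrite mulr_ge0.
have G20 j w : 0 <= G2 j w.
  by rewrite /G2; case: ifP => // _; rewrite mulr_ge0// mulr_ge0.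
exists (fun w => kC * v ts + G1 w + \sum_(j < J) G2 j w); last first.
  move=> w x /andP[T0x xts] xcross.
  have S0 : 0 <= \sum_(j < J) G2 j w by apply: sumr_ge0.
  have x0 := le_trans T00 T0x.
  have [xk|kx] := leP (weak_bias x) (kC * v ts).
    by apply: le_trans xk _; rewrite -addrA lerDl addr_ge0.
  have [xb|bx] := leP (weak_bias x) b0.
    have bts : kC * v ts < weak_bias ts.
      by move: (lt_le_trans kx xb); rewrite /b0 lt_max ltxx orbF.
    have b0E : b0 = weak_bias ts by apply: max_l; exact: ltW.
    apply: (@le_trans _ _ (G1 w)); last by rewrite addrAC lerDr addr_ge0//; lra.
    rewrite /G1 (ltW bts); apply: le_trans xb _; rewrite b0E ler_peMr//.
    by apply: E1; exact: xcross.
  have [xb0|[[j jJ /andP[bjx xbj]]|bJx]] := grid_cases b J (weak_bias x).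
  - by move: xb0; rewrite /b expr0 mul1r leNgt bx.
  - have bjT : b j <= weak_bias T0.
      by apply: le_trans (ltW bjx) _; apply: le_bias => //; rewrite T00 T0x.
    have [/andP[Ttj tjts] bE] := Htj j bjT.
    (* The weak bias is larger at [x] than at [tj j] and never increases, so [tj j] is later and the
       residual there is at most [kap]. *)
    have xtj : x < tj j.
      rewrite ltNge; apply/negP => tjx; move: bjx; rewrite -bE ltNge => /negP; apply.
      by apply: le_bias => //; rewrite tjx (le_trans T00 Ttj).
    apply: (@le_trans _ _ (G2 j w)); last first.
      rewrite (bigD1 (Ordinal jJ))//= addrCA lerDl addr_ge0//; last exact: sumr_ge0.
      by rewrite addr_ge0//; lra.
    rewrite /G2 bjT; apply: le_trans xbj _; rewrite {1}/b exprS -mulrA -/(b j) -bE.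
    by rewrite ler_wpM2l// ler_peMr// E1// xcross.
  - exfalso; have : weak_bias x <= weak_bias T0.
      by apply: le_bias => //; rewrite T00 T0x.
    by move: HJ bJx; lra.
have Db0 : D%:R / b0 <= v ts.
  rewrite ler_pdivrMr// -rD2 expr2; apply: ler_pM => //; last by lra.
have e20 := expR_ge0 (2 : R).
have K1 : 0 <= 2048 * expR 2 :> R by exact: mulr_ge0 (ler0n R 2048) e20.
have K2 : 0 <= 4096 * expR 2 :> R by exact: mulr_ge0 (ler0n R 4096) e20.
have vts0 : 0 <= v ts by lra.
have M1' : mean_le R d T P G1 (2048 * expR 2 * v ts).
  have [bts|bts] := boolP (kC * v ts <= weak_bias ts); last first.
    have -> : G1 = (fun=> 0) by apply/funext => w; rewrite /G1 (negPf bts).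
    by apply: mean_leW (mean_le_cst P 0 (lexx 0)); exact: mulr_ge0.
  have -> : G1 = (fun w => weak_bias ts * E ts w).
    by apply/funext => w; rewrite /G1 bts.
  apply: mean_leW (Emean ts _ bts); last by rewrite T0ts lexx.
  have b0E : b0 = weak_bias ts by exact: max_l.
  by rewrite -b0E -mulrA; apply: ler_wpM2l.
have M2' j : mean_le R d T P (G2 j) (4096 * expR 2 * v ts / 2 ^+ j).
  have [bj|bj] := boolP (b j <= weak_bias T0); last first.
    have -> : G2 j = (fun=> 0) by apply/funext => w; rewrite /G2 (negPf bj).
    apply: mean_leW (mean_le_cst P 0 (lexx 0)).
    by apply: divr_ge0; [exact: mulr_ge0|exact: exprn_ge0].
  have -> : G2 j = (fun w => 2 * (weak_bias (tj j) * E (tj j) w)).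
    by apply/funext => w; rewrite /G2 bj.
  have [tjts bE] := Htj j bj.
  have kb : kC * v ts <= weak_bias (tj j) by rewrite bE; exact: le_trans (b0b j).
  have H := mean_leZ P 2 _ _ (ler0n R 2) (Emean (tj j) tjts kb).
  apply: mean_leW H; rewrite bE.
  have p2 : 0 < 2 ^+ j :> R by rewrite exprn_gt0.
  have -> : 2 * (2048 * expR 2 * D%:R / b j) =
     4096 * expR 2 / 2 ^+ j * (D%:R / b0).
    by rewrite /b; field; rewrite gt_eqF//= gt_eqF.
  have -> : 4096 * expR 2 * v ts / 2 ^+ j = 4096 * expR 2 / 2 ^+ j * v ts by rewrite mulrAC.
  have X : 0 <= 4096 * expR 2 / 2 ^+ j :> R by exact: divr_ge0 K2 (ltW p2).
  by rewrite (ler_wpM2l X Db0).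
have C0 : mean_le R d T P (fun=> kC * v ts) (kC * v ts) by apply: mean_le_cst; lra.
have S2 := mean_le_sum P _ (index_enum 'I_J) _ _ M2'.
apply: mean_leW (mean_leD _ _ _ _ _ (mean_leD _ _ _ _ _ C0 M1') S2).
rewrite -mulr_sumr; have geo (n : nat) : \sum_(k < n) (2 ^+ k)^-1 <= 2 :> R.
  have -> : \sum_(k < n) (2 ^+ k)^-1 = 2 - 2 / 2 ^+ n :> R.
    elim: n => [|n IH]; first by rewrite big_ord0 expr0; field.
    rewrite big_ord_recr/= IH exprS; field.
    by rewrite expf_neq0.
  by rewrite lerBlDr lerDl divr_ge0// exprn_ge0.
have := ler_wpM2l (mulr_ge0 K2 vts0) (geo J).
rewrite /kL; lra.
Qed.

Local Notation strong_bias := (bias la (fun i => m i ^+ 2)).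

(** The 4 lets [landweber_decay] act between 2 ts and kK ts. The other term ensures 64 kA <= c kK^2,
    so that the weak bias at kK ts is at most c v. *)
Definition kK : R := 4 + 64 * kA L q / c.
Definition k_risk : R := 32 * kK ^+ 4 * kU + 40 * M ^+ 2 * kL + 8.

Let kK4 : 4 <= kK.
Proof. by rewrite lerDl divr_ge0 ?(ltW c0)// mulr_ge0// ltW// kA0. Qed.

Let kK_sq : 64 * kA L q <= c * kK ^+ 2.
Proof.
have h : 64 * kA L q / c <= kK by rewrite lerDr.
apply: (@le_trans _ _ (c * kK)); first by rewrite [leRHS]mulrC -ler_pdivrMr.
by apply: ler_wpM2l; [exact: ltW|have := kK4; nra].
Qed.

Let c_le : c <= 4^-1.
Proof.
have /andP[Ck0 _] := CkCo; rewrite /c; have Co0 : 0 < Co by exact: lt_le_trans Co1.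
by have : 0 <= Ck / Co; [rewrite divr_ge0// ltW|lra].
Qed.

Let kU0 : 0 <= kU.
Proof.
have cW := ltW c0; have MW := ltW M0.
have X1 : 0 <= (32 / c) ^+ p.+1 by rewrite exprn_ge0// divr_ge0.
have X2 : 0 <= M ^+ 4 by rewrite exprn_ge0.
have X3 := expR_ge0 (2 : R).
apply: addr_ge0; first exact: mulr_ge0 (ler0n R 128) (expR_ge0 1).
exact: mulr_ge0 (mulr_ge0 (mulr_ge0 (mulr_ge0 (ler0n R 4096) X3) X2)
    (ler0n R _)) X1.
Qed.

Let kL0 : 0 <= kL.
Proof.
apply: addr_ge0; first by have := kC_ge1; lra.
exact: mulr_ge0 (ler0n R 10240) (expR_ge0 2).
Qed.

Let strong_var_ge0 t : 0 <= strong_var la t.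
Proof. by apply: sumr_ge0 => i _; rewrite divr_ge0 ?sqr_ge0. Qed.

Lemma risk_bound ts (tau : T -> R) : T0 <= ts ->
  (forall t, ts < t -> strong_bias t <= strong_var la t) ->
  (forall w, T0 <= tau w) ->
  (forall w t, T0 <= t < tau w -> kap < rr t w) ->
  (forall w t, tau w < t -> rr t w <= kap) ->
  exists2 F : T -> R,
    mean_le R d T P F (k_risk * (strong_var la ts + strong_bias ts)) &
    forall w, \sum_i (g (tau w) (la i) / la i * eps i w -
      (1 - g (tau w) (la i)) * m i) ^+ 2 <= F w.
Proof.
move=> T0ts Hts T0tau before after.
have vts1 := v_ge1 ts T0ts.
have ts0 : 0 < ts.
  rewrite lt_neqAle (le_trans T00 T0ts) andbT; apply/eqP => ts0.
  move: vts1; rewrite -ts0 /weak_var big1 ?ler10// => i _.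
  by rewrite landweber0 expr0n.
have K0 : 0 < kK by have := kK4; lra.
pose t1 := kK * ts.
have t10 : 0 < t1 by rewrite mulr_gt0.
have T0t1 : T0 <= t1 by apply: le_trans T0ts _; rewrite ler_peMl ?(ltW ts0)//; have := kK4; lra.
have m0 i : 0 <= m i ^+ 2 by exact: sqr_ge0.
have ts2 : 0 <= 2 * ts by lra.
have b1 : weak_bias t1 <= c * v t1.
  (* The balance of bias and variance is available only strictly after [ts], so it is used at 2
     ts. *)
  have h1 : weak_bias t1 <= 4 / t1 ^+ 2 * strong_bias (2 * ts).
    rewrite mulr_sumr; apply: ler_sum => i _.
    have t12 : 2 * (2 * ts) <= t1 by rewrite /t1; have := kK4; nra.
    have := ler_wpM2r (m0 i) (landweber_decay (2 * ts) t1 _ (la01 i) ts2 t10 t12).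
    by rewrite [in X in _ -> X <= _]mulrCA !mulrA.
  have h2 : strong_bias (2 * ts) <= strong_var la (2 * ts) by apply: Hts; lra.
  have vle : v (2 * ts) <= v t1.
    by rewrite le_weak_var// ts2/= ler_wpM2r ?(ltW ts0)//; have := kK4; lra.
  have v2 : 1 <= v (2 * ts) by apply: v_ge1; lra.
  have h3 := strong_var_le_weak L q la L2 q0 q1 la01 la_hi (2 * ts) ts2 v2.
  have h4 : strong_bias (2 * ts) <= 16 * kA L q * ts ^+ 2 * v t1.
    apply: le_trans h2 (le_trans h3 _).
    have -> : 4 * kA L q * (2 * ts) ^+ 2 * v (2 * ts) =
      16 * kA L q * ts ^+ 2 * v (2 * ts) by ring.
    by rewrite ler_wpM2l// mulr_ge0 ?sqr_ge0// mulr_ge0// ltW// kA0.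
  apply: le_trans h1 _; rewrite mulrAC ler_pdivrMr ?exprn_gt0//.
  have : c * v t1 * t1 ^+ 2 = c * kK ^+ 2 * (ts ^+ 2 * v t1) by rewrite /t1; ring.
  move=> ->.
  have : 64 * kA L q * (ts ^+ 2 * v t1) <= c * kK ^+ 2 * (ts ^+ 2 * v t1).
    by apply: ler_wpM2r => //; rewrite mulr_ge0 ?sqr_ge0//; lra.
  lra.
have K8 : 8 * kA L q <= kK ^+ 2.
  have := kK_sq; have := kA0.
  have : c * kK ^+ 2 <= 4^-1 * kK ^+ 2 by rewrite ler_wpM2r ?sqr_ge0.
  lra.
have [n0 n0D [n0la n0v]] := weak_var_level L q la L2 q0 q1 la01 la_dec la_hi
  kK ts (ltW ts0) vts1 K0 K8.
have rDn : rD / 2 <= n0%:R by apply: le_trans n0v; have := rD_le ts T0ts; lra.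
have [FU FUm FUle] := noise_after_crossing t1 n0 T0t1 b1 n0D n0la rDn.
have [FL FLm FLle] := bias_before_crossing ts T0ts.
have lastD : (D.-1 < D)%N by rewrite prednK.
pose z := Ordinal lastD.
have /andP[z0 _] := la01 z.
(* The cap is needed for large [ts]: the strong variance stays below D / la_z^2, with la_z the
   smallest singular value, while ts^2 v does not stay bounded. *)
pose W := Num.min (4 * ts ^+ 2) (la z ^- 2).
have W0 : 0 <= W by rewrite le_min mulr_ge0 ?sqr_ge0//= invr_ge0 sqr_ge0.
have WV : W * v ts <= 20 * M ^+ 2 * strong_var la ts.
  have Wle : W <= 4 * ts ^+ 2 by rewrite ge_min lexx.
  have H := weak_var_le_strong L M la L2 M0 la01 la_dec la_lo ts W
    (ltW ts0) W0 Wle.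
  apply: H.
  move=> i iD; have -> : i = z by apply: val_inj; exact: (congr1 predn iD).
  by rewrite -ler_pdivlMr ?exprn_gt0// mul1r ge_min lexx orbT.
(* Where W la_i^2 >= 1 the weak bias dominates. Elsewhere the cap is not active, so ts la_i < 1/2,
   the filter at [ts] is at most 1/2, and the strong bias at [ts] retains a quarter of the squared
   coefficient. *)
have bias_split x : 0 <= x <= ts ->
    strong_bias x <= W * weak_bias x + 4 * strong_bias ts.
  move=> /andP[x0 xts]; rewrite !mulr_sumr -big_split/=; apply: ler_sum => i _.
  have gx0 := landweber_ge0 x _ (la01 i) x0.
  have gx1 := landweber_le1 x _ (la01 i) x0.
  set gx := (1 - g x (la i)) ^+ 2; set gs := (1 - g ts (la i)) ^+ 2.
  have gx2 : 0 <= gx <= 1 by rewrite sqr_ge0 expr_le1//; lra.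
  have gs0 : 0 <= gs by exact: sqr_ge0.
  have /andP[li0 _] := la01 i.
  have mi := m0 i.
  have -> : W * (gx * (la i ^+ 2 * m i ^+ 2)) + 4 * (gs * m i ^+ 2) =
    (W * la i ^+ 2 * gx + 4 * gs) * m i ^+ 2 by ring.
  apply: ler_wpM2r => //; have /andP[gx20 gx21] := gx2.
  have [W1|W1] := leP 1 (W * la i ^+ 2); first by nra.
  suff : 1 <= 4 * gs.
    have := mulr_ge0 (mulr_ge0 W0 (sqr_ge0 (la i))) gx20; lra.
  have [W4|W4] := leP (4 * ts ^+ 2) (la z ^- 2).
    have WE : W = 4 * ts ^+ 2 by exact: min_l.
    have tl : (ts * la i) ^+ 2 <= 4^-1 by move: W1; rewrite WE exprMn; lra.
    have := landweber_upper ts _ (la01 i) (ltW ts0); rewrite min_l; last lra.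
    by have := landweber_ge0 ts _ (la01 i) (ltW ts0); rewrite /gs; nra.
  have WE : W = la z ^- 2 by apply: min_r; exact: ltW.
  exfalso; move: W1; rewrite WE mulrC ltr_pdivrMr ?exprn_gt0// mul1r ltNge.
  move=> /negP; apply; apply: lerXn2r; rewrite ?nnegrE ?(ltW z0) ?(ltW li0)//.
  by apply: la_dec; rewrite /= -ltnS prednK.
have sb0 : 0 <= strong_bias ts by exact: bias_ge0.
have FL0 w : 0 <= FL w by have [_ ->] := FLm.
exists (fun w => 2 * FU w + 2 * W * FL w + 8 * strong_bias ts); last first.
  move=> w; set x := tau w; have x0 : 0 <= x by exact: le_trans (T0tau w).
  have noise := FUle w x x0 (before w).
  have bias_x : strong_bias x <= W * FL w + 4 * strong_bias ts.
    have [xts|tsx] := ltP x ts.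
      apply: le_trans (bias_split x _) _; first by rewrite x0 ltW.
      rewrite lerD2r ler_wpM2l//; apply: FLle; last exact: after.
      by rewrite T0tau xts.
    apply: (@le_trans _ _ (strong_bias ts)).
      by apply: le_bias => //; rewrite (ltW ts0) tsx.
    by have := mulr_ge0 W0 (FL0 w); lra.
  apply: (@le_trans _ _ (2 * (\sum_i g x (la i) ^+ 2 / la i ^+ 2 * eps i w ^+ 2)
      + 2 * strong_bias x)); last lra.
  rewrite !mulr_sumr -big_split/=; apply: ler_sum => i _.
  have -> : 2 * (g x (la i) ^+ 2 / la i ^+ 2 * eps i w ^+ 2) =
    2 * (g x (la i) / la i * eps i w) ^+ 2 by rewrite -expr_div_n -exprMn.
  have -> : 2 * ((1 - g x (la i)) ^+ 2 * m i ^+ 2) =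
    2 * ((1 - g x (la i)) * m i) ^+ 2 by rewrite -exprMn.
  move: (g x (la i) / la i * eps i w) ((1 - g x (la i)) * m i) => y1 y2.
  by have := sqr_ge0 (y1 + y2); nra.
have M20 : 0 <= M ^+ 2 by exact: sqr_ge0.
have U := mean_leZ P 2 _ _ (ler0n R 2) FUm.
have W20 : 0 <= 2 * W by rewrite pmulr_rge0.
have sb80 : 0 <= 8 * strong_bias ts by rewrite pmulr_rge0.
have WL := mean_leZ P (2 * W) FL _ W20 FLm.
have BB := mean_le_cst P (8 * strong_bias ts) sb80.
apply: mean_leW (mean_leD _ _ _ _ _ (mean_leD _ _ _ _ _ U WL) BB).
have sU : strong_var la t1 <= 16 * kK ^+ 4 * strong_var la ts.
  by apply: strong_var_scale => //; [have := kK4; lra|exact: ltW].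
have hU := ler_wpM2l kU0 sU.
have hL := ler_wpM2l kL0 WV.
have V0 := strong_var_ge0 ts.
have kK40 : 0 <= kK ^+ 4 by rewrite exprn_ge0// ltW.
have q1' : 0 <= 32 * kK ^+ 4 * kU * strong_bias ts.
  exact: mulr_ge0 (mulr_ge0 (mulr_ge0 (ler0n R 32) kK40) kU0) sb0.
have q2' : 0 <= 40 * M ^+ 2 * kL * strong_bias ts.
  exact: mulr_ge0 (mulr_ge0 (mulr_ge0 (ler0n R 40) M20) kL0) sb0.
rewrite /k_risk; move: hU hL q1' q2' V0.
move: (kU) (kL) (strong_var la t1) (strong_var la ts) (strong_bias ts) => u l Vt Vs bs.
move: (kK ^+ 4) (M ^+ 2) (v ts) => k4 m2 vt; lra.
Qed.

End deviations.

(* The expectation of y^2 is bounded below through y^2 >= 1 - exp(-y^2), whose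
   expectation is explicit for a Gaussian variable y. *)
Lemma second_moment_ge (R : realType) (d : measure_display)
    (T : measurableType d) (P : probability T R) (X : {RV P >-> R}) (a b : R) :
  standard_normal X ->
  (((a ^+ 2 + b ^+ 2) / 10)%:E <= \int[P]_w ((a * X w - b) ^+ 2)%:E)%E.
Proof.
move=> nX; set N := a ^+ 2 + b ^+ 2.
have N0 : 0 <= N by rewrite addr_ge0 ?sqr_ge0.
have [->|Nn0] := eqVneq N 0.
  by rewrite mul0r; apply: integral_ge0 => w _; rewrite lee_fin sqr_ge0.
have Np : 0 < N by rewrite lt_neqAle eq_sym Nn0.
pose al := a ^+ 2 / N; pose be := b ^+ 2 / N.
have al0 : 0 <= al by rewrite divr_ge0 ?sqr_ge0.
have be0 : 0 <= be by rewrite divr_ge0 ?sqr_ge0.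
have abE : al + be = 1 by rewrite -mulrDl divff.
pose e w := expR (- al * X w ^+ 2 + (2 * a * b / N) * X w + - be).
have eE w : N * e w >= N - (a * X w - b) ^+ 2.
  have -> : e w = expR (- ((a * X w - b) ^+ 2 / N)).
    by congr expR; rewrite /al /be; field.
  have := ler_wpM2l N0 (expR_ge1Dx (- ((a * X w - b) ^+ 2 / N))).
  by rewrite mulrDr mulr1 mulrN mulrC divfK.
have al2 : - al < 2^-1 by lra.
have := integral_expR_quadratic_normal R d T P X (- al) (2 * a * b / N) (- be) nX al2.
set c := (_ * expR _ : R) => Ie.
(* With u^2 = 1 + 2 al and exp (- x) <= 1 / (1 + x), c is at most u / (2 + al), where u <= 1 + al
   and al <= 1. The remaining tenth of [N] is the claim. *)
have c9 : c <= 9 / 10.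
  have sE : - be + (2 * a * b / N) ^+ 2 / (2 * (1 - 2 * - al)) = - (be / (1 + 2 * al)).
    have -> : (2 * a * b / N) ^+ 2 = 4 * al * be by rewrite /al /be; field.
    by field; do ?[apply/andP; split]; lra.
  rewrite /c sE; have -> : 1 - 2 * - al = 1 + 2 * al by ring.
  have u1 : 1 <= 1 + 2 * al by lra.
  set u := Num.sqrt _; have u2 : u ^+ 2 = 1 + 2 * al by rewrite sqr_sqrtr//; lra.
  have u0 : 0 < u by rewrite sqrtr_gt0; lra.
  have ex : expR (- (be / (1 + 2 * al))) <= u ^+ 2 / (2 + al).
    have y0 : 0 < 1 + be / (1 + 2 * al) by rewrite ltr_wpDr// divr_ge0//; lra.
    rewrite expRN; apply: (@le_trans _ _ (1 + be / (1 + 2 * al))^-1).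
      by rewrite lef_pV2 ?posrE ?expR_gt0//; exact: expR_ge1Dx.
    have -> : 1 + be / (1 + 2 * al) = (2 + al) / u ^+ 2.
      have -> : be = 1 - al by lra.
      by rewrite u2; field; do ?[apply/andP; split]; lra.
    by rewrite invf_div.
  apply: (@le_trans _ _ (u^-1 * (u ^+ 2 / (2 + al)))).
    by rewrite ler_wpM2l// invr_ge0 ltW.
  have -> : u^-1 * (u ^+ 2 / (2 + al)) = u / (2 + al).
    by field; do ?[apply/andP; split]; lra.
  rewrite ler_pdivrMr; last lra.
  have : (u - 1) ^+ 2 >= 0 by exact: sqr_ge0.
  nra.
have me : measurable_fun setT (fun w => N * e w).
  apply: measurable_funM => //; apply: measurableT_comp => //.
  apply: measurable_funD => //; apply: measurable_funD; last exact: measurable_funM.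
  by apply: measurable_funM => //; exact: measurable_funX.
have ms : measurable_fun setT (fun w => (a * X w - b) ^+ 2).
  by apply: measurable_funX; apply: measurable_funB => //; exact: measurable_funM.
have N0e w : 0 <= N * e w by rewrite mulr_ge0// expR_ge0.
have : (N%:E <= \int[P]_w ((a * X w - b) ^+ 2)%:E + (N * c)%:E)%E.
  have -> : N%:E = (\int[P]_w N%:E)%E.
    by rewrite integral_cst//= probability_setT mule1.
  have -> : ((N * c)%:E = \int[P]_w (N * e w)%:E)%E.
    under eq_integral do rewrite EFinM.
    rewrite ge0_integralZl//; first by rewrite Ie EFinM.
      apply/measurable_EFinP; apply: measurableT_comp => //.
      apply: measurable_funD => //; apply: measurable_funD; last exact: measurable_funM.
      by apply: measurable_funM => //; exact: measurable_funX.
    by move=> w _; rewrite lee_fin expR_ge0.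
  rewrite -ge0_integralD//; last 4 first.
  - by move=> w _; rewrite lee_fin sqr_ge0.
  - exact/measurable_EFinP.
  - by move=> w _; rewrite lee_fin.
  - exact/measurable_EFinP.
  apply: ge0_le_integral => //.
  - by apply: emeasurable_funD; exact/measurable_EFinP.
  - by move=> w _; rewrite -EFinD lee_fin; have := eE w; lra.
rewrite -leeBlDr// -EFinB; apply: le_trans; rewrite lee_fin.
have := ler_wpM2l N0 c9; lra.
Qed.

(** * One-based indexing and crossing times *)

Lemma coord1S (R : realType) (D : nat) (x : 'rV[R]_D) (i : 'I_D) :
  coord1 x i.+1 = x 0 i.
Proof. by rewrite /coord1 /= valK. Qed.

Lemma ceil_divnS (k L : nat) : (0 < L)%N -> ceil_divn k.+1 L = (k %/ L).+1.
Proof. by move=> L0; rewrite /ceil_divn divnS//; case: (L %| _)%N => /=; lia. Qed.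

(** Stated for both [tau] and [t_strong]. The infimum itself is left out on purpose, as a claim
    there would call for continuity of [f]; the estimates above compare only with times strictly on
    one side. *)
Lemma inf_crossing (R : realType) (f : R -> R) (T0 c : R) :
  (forall t u, T0 <= t <= u -> f u <= f t) ->
  (exists2 t, T0 <= t & f t <= c) ->
  let tau := inf [set t : R | T0 <= t /\ f t <= c] in
  [/\ T0 <= tau, forall t, T0 <= t < tau -> c < f t &
    forall t, tau < t -> f t <= c].
Proof.
move=> fdec [t0 T0t ft0] tau; set S := [set t : R | _] in tau *.
have Sne : S !=set0 by exists t0.
have Slb : lbound S T0 by move=> t [].
split; first exact: lb_le_inf.
  move=> t /andP[T0t' ttau]; rewrite ltNge; apply/negP => ft.
  have : tau <= t by apply: ge_inf; [exists T0|].
  by rewrite leNgt ttau.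
move=> t taut; have [u [T0u fu] ut] := inf_lt Sne taut.
by apply: le_trans fu; apply: fdec; rewrite T0u ltW.
Qed.

(** * Reduction to unit noise level *)

Section normalisation.
Context {R : realType} {D : nat} (lam mu : 'rV[R]_D) (delta : R).
Hypothesis delta0 : 0 < delta.
Let la i := lam 0 i.
Let m i := mu 0 i / delta.
Local Notation g := (@landweber R).

Let d2 : 0 < delta ^+ 2. Proof. exact: exprn_gt0. Qed.

Lemma t_circE (Co : R) : t_circ g lam delta Co =
  inf [set t : R | 0 <= t /\ weak_var la t = Co * Num.sqrt D%:R].
Proof.
congr inf; apply/seteqP; split => t [t0 H]; split => //.
  apply: (mulfI (lt0r_neq0 d2)).
  by move: H; rewrite /variance_weak -/(weak_var la t) mulrC [in RHS]mulrC mulrC => ->; rewrite mulrC.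
by rewrite /variance_weak -/(weak_var la t) H mulrC.
Qed.

Lemma residual2E (eps : 'I_D -> R) (t : R) :
  residual2 g lam t (observation lam mu delta (\row_i eps i)) =
  delta ^+ 2 * bias la (fun i => (la i * m i + eps i) ^+ 2) t.
Proof.
rewrite /residual2 /bias mulr_sumr; apply: eq_bigr => i _.
by rewrite /observation !mxE /m /la; field; rewrite gt_eqF.
Qed.

Lemma bias2E (t : R) :
  bias2 g lam t mu = delta ^+ 2 * bias la (fun i => m i ^+ 2) t.
Proof.
rewrite /bias2 /bias mulr_sumr; apply: eq_bigr => i _.
by rewrite /m /la; field; rewrite gt_eqF.
Qed.

Lemma lossE (t : R) (eps : 'I_D -> R) : (forall i, 0 < la i <= 1) ->
  euclidean_norm (estimator g lam t (observation lam mu delta (\row_i eps i)) - mu) ^+ 2 =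
  delta ^+ 2 * \sum_i (g t (la i) / la i * eps i - (1 - g t (la i)) * m i) ^+ 2.
Proof.
move=> la01; rewrite /euclidean_norm sqr_sqrtr; last first.
  by apply: sumr_ge0 => i _; exact: sqr_ge0.
rewrite mulr_sumr; apply: eq_bigr => i _.
have /andP[li0 _] := la01 i.
rewrite /estimator /observation !mxE -/(la i) -exprMn; congr (_ ^+ 2).
rewrite /m; field.
by rewrite !gt_eqF.
Qed.

End normalisation.

Lemma weak_var_le_strong_var (R : realType) (D : nat) (la : 'I_D -> R) (t : R) :
  (forall i, 0 < la i <= 1) -> weak_var la t <= strong_var la t.
Proof.
move=> la01; apply: ler_sum => i _; have /andP[l0 l1] := la01 i.
by rewrite ler_pdivlMr ?exprn_gt0// ler_piMr ?sqr_ge0// expr_le1// ltW.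
Qed.

Theorem corollary4p1 (R : realType) (L : nat)
    (nu_minus nu_plus cmu Ckappa Ccirc : R)
    (hL : (2 <= L)%N)
    (hnu_minus : 0 < nu_minus) (hnu_plus : 0 < nu_plus)
    (hrho : 2 > Num.max nu_plus (1 + nu_plus / 2))
    (hcmu : 0 < cmu)
    (hCcirc : 1 <= Ccirc)
    (hCkappa : 0 <= Ckappa < Ccirc) :
  exists C : R,
    forall (D : nat) (delta : R) (lam : 'rV[R]_D) (kappa : R),
      (L <= D)%N -> (L %| D)%N ->
      Ccirc < Num.sqrt D%:R ->
      0 < delta ->
      (forall i : 'I_D, 0 < lam 0 i <= 1) ->
      (forall i j : 'I_D, (i <= j)%N -> lam 0 j <= lam 0 i) ->
      (forall k : nat, (L <= k <= D)%N ->
        0 < L%:R `^ (- nu_minus^-1)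
          <= coord1 lam k / coord1 lam (ceil_divn k L) /\
        coord1 lam k / coord1 lam (k %/ L)
          <= L%:R `^ (- nu_plus^-1) < 1) ->
      0 < kappa ->
      `|kappa - D%:R * delta ^+ 2| <= Ckappa * Num.sqrt D%:R * delta ^+ 2 ->
    forall (d : measure_display) (T : measurableType d) (P : probability T R)
      (eps : 'I_D -> {RV P >-> R}),
      mutually_independent eps ->
      (forall i : 'I_D, standard_normal (eps i)) ->
    forall mu : 'rV[R]_D, signal_class L cmu mu ->
      let Y := fun w : T =>
        observation lam mu delta (\row_(i < D) eps i w) in
      let muhat := fun (t : R) (w : T) => estimator (@landweber R) lam t (Y w) in
      let tau_w := fun w : T =>
        tau (@landweber R) lam delta Ccirc kappa (Y w) in
      let t_s := t_strong (@landweber R) lam delta Ccirc mu in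
      ('E_P[fun w => (euclidean_norm (muhat (tau_w w) w - mu) ^+ 2)%R]
       <= C%:E * 'E_P[fun w => (euclidean_norm (muhat t_s w - mu) ^+ 2)%R])%E.
Proof.
have L0 : (0 < L)%N by exact: leq_trans hL.
have Lr1 : 1 < L%:R :> R by rewrite ltr1n.
have Lr0 : 0 < L%:R :> R by rewrite ltr0n.
pose M : R := L%:R `^ nu_minus^-1; pose q : R := L%:R `^ (- nu_plus^-1).
have M0 : 0 < M by exact: powR_gt0.
have q0 : 0 <= q by exact: powR_ge0.
(* The product is L^(1 - 2/nu_plus), and the exponent is negative because rho = 2 exceeds
   nu_plus. *)
have q1 : q ^+ 2 * L%:R < 1.
  have nu2 : nu_plus < 2 by move: hrho; rewrite gt_max => /andP[].
  have -> : q ^+ 2 * L%:R = L%:R `^ (1 - 2 / nu_plus).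
    rewrite -[in LHS](powRr1 (ltW Lr0)) -powR_mulrn ?powR_ge0// -powRrM.
    rewrite powRr1 ?(ltW Lr0)//; rewrite -{2}[L%:R](powRr1 (ltW Lr0)) -powRD.
      by congr (_ `^ _); ring.
    by apply/implyP => _; rewrite gt_eqF.
  rewrite /powR gt_eqF// expR_lt1 pmulr_llt0 ?ln_gt0//.
  by rewrite subr_lt0 ltr_pdivlMr// mul1r.
have [p hp] : exists p, 2 * M ^+ 4 <= L%:R ^+ p.+1.
  have X0 : 0 <= 2 * M ^+ 4 by rewrite mulr_ge0// exprn_ge0// ltW.
  exists (Num.bound (2 * M ^+ 4)); apply: le_trans (ltW (archi_boundP X0)) _.
  rewrite -natrX ler_nat; apply: leq_trans (leq_trans (ltnW (ltn_expl _ (isT : 1 < 2)%N)) _) _.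
    exact: (leq_pexp2l (isT : 0 < 2)%N (leqnSn _)).
  by rewrite leq_exp2r.
(* [k_risk] compares the loss at [tau] with squared bias plus variance at [t_s], and 10 undoes
   [second_moment_ge]. All ingredients are fixed before [D], the noise level and the signal. *)
exists (10 * k_risk L M q Ckappa Ccirc p).
move=> D delta lam kappa LD _ CoD delta0 la01 la_dec hspec kappa0 hkappa.
move=> d T P eps indep nor mu _.
pose Y w := observation lam mu delta (\row_(i < D) eps i w).
pose muhat t w := estimator (@landweber R) lam t (Y w).
pose tau_w w := tau (@landweber R) lam delta Ccirc kappa (Y w).
pose t_s := t_strong (@landweber R) lam delta Ccirc mu.
change ('E_P[fun w => (euclidean_norm (muhat (tau_w w) w - mu) ^+ 2)%R] <=
  (10 * k_risk L M q Ckappa Ccirc p)%:E *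
  'E_P[fun w => (euclidean_norm (muhat t_s w - mu) ^+ 2)%R])%E.
pose la i := lam 0 i; pose m i := mu 0 i / delta.
have D0 : (0 < D)%N by exact: leq_trans LD.
have d2 : 0 < delta ^+ 2 by exact: exprn_gt0.
have la0 i : 0 < la i by have /andP[] := la01 i.
have lo_hi (i j : 'I_D) : (L <= i.+1)%N -> j = (i %/ L)%N :> nat -> la j <= M * la i.
  move=> Li ji; have [|] := hspec i.+1; first by rewrite Li ltn_ord.
  move=> /andP[_]; rewrite ceil_divnS// -ji !coord1S powRN -/M => H _.
  by move: H; rewrite ler_pdivlMr// mulrC ler_pdivrMr// mulrC.
(* The spectral condition starts at the one-based index [L]. For smaller indices the quotient is 0,
   as it is for the zero-based index [L.-1], and monotonicity passes from there to [i]. *)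
have la_lo (i j : 'I_D) : j = (i %/ L)%N :> nat -> la j <= M * la i.
  move=> ji; have [Li|iL] := leqP L i.+1; first exact: lo_hi.
  have lD : (L.-1 < D)%N by rewrite prednK.
  have jl : j = (Ordinal lD %/ L)%N :> nat.
    by rewrite ji /= !divn_small// ?prednK//; exact: ltnW.
  apply: le_trans (lo_hi (Ordinal lD) j _ jl) _; first by rewrite /= prednK.
  by rewrite ler_wpM2l ?(ltW M0)// la_dec//= -ltnS prednK// ltnW.
have la_hi (i j : 'I_D) : j.+1 = (i.+1 %/ L)%N -> la i <= q * la j.
  move=> ji; have Li : (L <= i.+1)%N.
    by rewrite leqNgt; apply/negP => /divn_small; rewrite -ji.
  have [|_ /andP[]] := hspec i.+1; first by rewrite Li ltn_ord.
  by rewrite -ji !coord1S ler_pdivrMr.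
pose T0 := t_circ (@landweber R) lam delta Ccirc.
have rD0 : 0 <= Num.sqrt (D%:R : R) by exact: sqrtr_ge0.
have rD2 : Num.sqrt (D%:R : R) ^+ 2 = D%:R by rewrite sqr_sqrtr.
have [T00 vT0] : 0 <= T0 /\ weak_var la T0 = Ccirc * Num.sqrt D%:R.
  rewrite /T0 (t_circE lam delta delta0); apply: level_inf => //.
  apply/andP; split; first by rewrite mulr_ge0// (le_trans ler01).
  by rewrite -[ltRHS]rD2 expr2 ltr_pM2r// sqrtr_gt0 ltr0n.
pose kap := kappa / delta ^+ 2.
have hkap : `|kap - D%:R| <= Ckappa * Num.sqrt D%:R.
  have -> : kap - D%:R = (kappa - D%:R * delta ^+ 2) / delta ^+ 2.
    by rewrite mulrBl mulfK// gt_eqF.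
  by rewrite normrM normfV (gtr0_norm d2) ler_pdivrMr.
pose rr w := bias la (fun i => (la i * m i + eps i w) ^+ 2).
have tauP w : [/\ T0 <= tau_w w, forall t, T0 <= t < tau_w w -> kap < rr w t &
    forall t, tau_w w < t -> rr w t <= kap].
  have -> : tau_w w = inf [set t : R | T0 <= t /\ rr w t <= kap].
    congr inf; apply/seteqP; split => t [T0t H]; split => //; move: H;
      by rewrite residual2E// -ler_pdivlMl// mulrC.
  have c0 i : 0 <= (la i * m i + eps i w) ^+ 2 by exact: sqr_ge0.
  apply: inf_crossing => [t u /andP[T0t tu]|].
    by apply: le_bias => //; rewrite (le_trans T00 T0t).
  have kap0 : 0 < kap by exact: divr_gt0.
  have [t1 t10 Ht1] := bias_vanish la la01 _ kap c0 kap0.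
  exists (Num.max T0 t1); first by rewrite le_max lexx.
  by apply: Ht1; rewrite le_max lexx orbT.
have m0 i : 0 <= m i ^+ 2 by exact: sqr_ge0.
pose sb := bias la (fun i => m i ^+ 2).
(* The bias tends to 0, so a positive variance makes the set defining [t_s] nonempty; otherwise its
   infimum would be a default value. Positivity of [kap] served the same purpose for [tau]. *)
have V0 : 0 < strong_var la T0.
  apply: lt_le_trans (weak_var_le_strong_var _ _ la T0 la01).
  by rewrite vT0 mulr_gt0//; [lra|rewrite sqrtr_gt0 ltr0n].
have [T0ts _ Hts] : [/\ T0 <= t_s,
    forall t, T0 <= t < t_s -> 0 < sb t - strong_var la t &
    forall t, t_s < t -> sb t - strong_var la t <= 0].
  have -> : t_s = inf [set t : R | T0 <= t /\ sb t - strong_var la t <= 0].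
    congr inf; apply/seteqP; split => t [T0t H]; split => //; move: H;
      by rewrite (bias2E lam mu delta delta0) -/(strong_var la t) ler_pM2l// subr_le0.
  apply: (inf_crossing R (fun t => sb t - strong_var la t)) => [t u /andP[T0t tu]|].
    apply: lerB; first by apply: le_bias => //; rewrite (le_trans T00 T0t).
    by apply: le_strong_var => //; rewrite (le_trans T00 T0t).
  have [t1 t10 Ht1] := bias_vanish la la01 _ _ m0 V0.
  exists (Num.max T0 t1); first by rewrite le_max lexx.
  rewrite subr_le0; apply: (@le_trans _ _ (strong_var la T0)).
    by apply: Ht1; rewrite le_max lexx orbT.
  by apply: le_strong_var => //; rewrite T00 le_max lexx.
have Hts' t : t_s < t -> sb t <= strong_var la t.
  by move=> /Hts; rewrite subr_le0.
have ts0 : 0 <= t_s by exact: le_trans T0ts.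
have [F FV FW] := risk_bound L M q la hL M0 q0 q1 la01 la_dec la_lo la_hi P eps
  indep nor m kap Ckappa Ccirc T0 D0 hCcirc hCkappa hkap T00 vT0 p hp t_s tau_w
  T0ts Hts' (fun w => let: And3 H _ _ := tauP w in H)
  (fun w => let: And3 _ H _ := tauP w in H)
  (fun w => let: And3 _ _ H := tauP w in H).
set k := k_risk _ _ _ _ _ _ in FV *.
pose S := strong_var la t_s + sb t_s.
have S0 : 0 < S.
  rewrite ltr_pwDl ?bias_ge0//; apply: lt_le_trans V0 _.
  by apply: le_strong_var => //; rewrite T00.
(* Read off from the bound itself: k S dominates the mean of a nonnegative function and S > 0. *)
have k0 : 0 <= k.
  have [mF F0 Fk] := FV; rewrite -(pmulr_lge0 _ S0) -lee_fin.
  by apply: le_trans Fk; apply: integral_ge0 => w _; rewrite lee_fin.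
apply: (@le_trans _ _ (delta ^+ 2 * (k * S))%:E).
  apply: (expectation_mean_le P _ (fun w => delta ^+ 2 * F w)).
  - by move=> w; exact: sqr_ge0.
  - move=> w; rewrite /muhat /Y (lossE lam mu delta delta0 _ (fun i => eps i w))//.
    by rewrite ler_pM2l.
  - by apply: mean_leZ => //; exact: ltW.
(* At the deterministic time [t_s] each coordinate of the error is affine in a single Gaussian, so
   [second_moment_ge] applies term by term. *)
have lower : ((delta ^+ 2 * (S / 10))%:E <=
    'E_P[fun w => (euclidean_norm (muhat t_s w - mu) ^+ 2)%R])%E.
  rewrite unlock; under eq_integral.
    move=> w _; rewrite /muhat /Y (lossE lam mu delta delta0 _ (fun i => eps i w))//.
    rewrite EFinM -sumEFin; over.
  have ms i : measurable_fun setT (fun w =>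
      (landweber t_s (la i) / la i * eps i w -
      (1 - landweber t_s (la i)) * m i) ^+ 2).
    apply: measurable_funX; apply: measurable_funB => //.
    exact: measurable_funM.
  rewrite ge0_integralZl//; last 3 first.
  - apply: emeasurable_sum => i; exact/measurable_EFinP.
  - by move=> w _; apply: sume_ge0 => i _; rewrite lee_fin sqr_ge0.
  - by rewrite lee_fin ltW.
  rewrite EFinM; apply: lee_wpmul2l; first by rewrite lee_fin ltW.
  rewrite ge0_integral_sum//; last 2 first.
  - by move=> i; exact/measurable_EFinP.
  - by move=> i w _; rewrite lee_fin sqr_ge0.
  have -> : S / 10 = \sum_i ((landweber t_s (la i) / la i) ^+ 2 +
      ((1 - landweber t_s (la i)) * m i) ^+ 2) / 10.
    rewrite -mulr_suml big_split/=; congr ((_ + _) / _).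
      by apply: eq_bigr => i _; rewrite expr_div_n.
    by apply: eq_bigr => i _; rewrite [RHS]exprMn.
  rewrite -sumEFin; apply: lee_sum => i _; exact: second_moment_ge.
have C0 : (0 <= (10 * k)%:E)%E by rewrite lee_fin mulr_ge0.
apply: le_trans (lee_wpmul2l C0 lower).
rewrite -EFinM lee_fin; have -> : 10 * k * (delta ^+ 2 * (S / 10)) =
  delta ^+ 2 * (k * S) by field.
exact: lexx.
Qed.
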